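(* Consider $\min f(x)$ s.t. $g(x)\in K$ with $f,g$ twice continuously differentiable, $K\subseteq\mathbb{R}^m$ closed, $C:=g^{-1}(K)$. Let $d\in T_C(\bar x)$, let $\bar x$ be a local optimal solution in direction $d$, suppose $\nabla f(\bar x)d=0$ and MSCQ holds at $\bar x$ in direction $d$ for $g(x)\in K$. Then: (a) there exists $\lambda\in\Lambda(\bar x;d)$ with $\sigma_\Theta(\lambda)\le0$ and $\lambda\in N_{T_K^{''}(g(\bar x);\nabla g(\bar x)d)}(0)$; (b) if $T_K^2(g(\bar x);\nabla g(\bar x)d)\neq\emptyset$, there exists $\lambda\in\Lambda(\bar x;d)$ with $\nabla^2_{xx}L(\bar x,\lambda)(d,d)-\sigma_\Omega(\lambda)\ge0$, and moreover there exist sequences $w_k\in T_C^2(\bar x;d)$ and $\lambda_k\in N_{T_K^2(g(\bar x);\nabla g(\bar x)d)}\big(\nabla g(\bar x)w_k+\nabla^2g(\bar x)(d,d)\big)$ such that $\nabla f(\bar x)w_k+\nabla^2f(\bar x)(d,d)\to\alpha$, $\langle\nabla g(\bar x)^T\lambda_k+\nabla f(\bar x),w_k\rangle\to0$, and $\lambda_k\to\lambda$, where $\alpha:=\inf_{w\in T_C^2(\bar x;d)}(\nabla f(\bar x)w+\nabla^2f(\bar x)(d,d))$.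
   Context: $L(x,\lambda):=f(x)+\langle\lambda,g(x)\rangle$. The M-multiplier set in direction $d$ is $\Lambda(\bar x;d):=\{\lambda\in\mathbb{R}^m\mid \lambda\in N_K(g(\bar x);\nabla g(\bar x)d),\ \nabla_xL(\bar x,\lambda)=0\}$, where $N_K(\bar y;v):=\limsup_{t\downarrow0,v'\to v}\hat N_K(\bar y+tv')$ is the directional limiting normal cone; $N_A(\cdot)$ is the limiting normal cone. $\Theta:=\nabla g(\bar x)(T_C^{''}(\bar x;d))$, $\Omega:=\nabla g(\bar x)(T_C^2(\bar x;d))+\nabla^2g(\bar x)(d,d)$, $\nabla^2g(\bar x)(d,d):=(d^T\nabla^2g_i(\bar x)d)_i$. $T_S^2(\bar y;v):=\{w\mid \exists t_k\downarrow 0,\ w_k\to w,\ \bar y+t_kv+\tfrac12 t_k^2w_k\in S\}$; $T_S^{''}(\bar y;v):=\{w\mid \exists (t_k,r_k)\downarrow(0,0),\ w_k\to w,\ t_k/r_k\to0,\ \bar y+t_kv+\tfrac12 t_kr_kw_k\in S\}$. $\sigma_S(\lambda):=\sup_{u\in S}\langle\lambda,u\rangle$. $V_{\rho,\delta}(d):=\{w\in\delta B\mid \|\,\|d\|w-\|w\|d\,\|\le\rho\|w\|\|d\|\}$; local optimality in direction $d$: $f(x)\ge f(\bar x)$ on $C\cap(\bar x+V_{\rho,\delta}(d))$ for some $\rho,\delta>0$. MSCQ at $\bar x$ in direction $d$: $\mathrm{dist}(x,g^{-1}(K))\le\kappa\,\mathrm{dist}(g(x),K)$ for all $x\in\bar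 x+V_{\rho,\delta}(d)$, for some $\rho,\delta,\kappa>0$. *)

(* Defs.v *)
From HB Require Import structures.
From mathcomp Require Import all_boot all_order all_algebra.
From mathcomp Require Import all_classical all_reals all_analysis.
Set Implicit Arguments. Unset Strict Implicit. Unset Printing Implicit Defensive.
Import Order.TTheory GRing.Theory Num.Theory.
Import numFieldNormedType.Exports.
Local Open Scope classical_set_scope.
Local Open Scope ring_scope.

Section Defs.
Variable R : realType.

Definition dotp n (u v : 'rV[R]_n) : R := \sum_(i < n) u ord0 i * v ord0 i.
Definition enorm n (u : 'rV[R]_n) : R := Num.sqrt (dotp u u).

Definition quadf n (H : 'M[R]_n) (d : 'rV[R]_n) : R := (d *m H *m d^T) ord0 ord0.

(* F : R^n -> R is twice continuously differentiable with gradient G and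
   Hessian H (H x i j = d/dx_j (d/dx_i F)). *)
Definition C2 n (F : 'rV[R]_n -> R) (G : 'rV[R]_n -> 'rV[R]_n)
  (H : 'rV[R]_n -> 'M[R]_n) : Prop :=
  [/\ forall x, differentiable F x /\ ('d F x : 'rV[R]_n -> R) =1 (fun v => dotp (G x) v),
      continuous G,
      forall x, differentiable G x /\
        ('d G x : 'rV[R]_n -> 'rV[R]_n) =1 (fun v => v *m (H x)^T)
    & continuous H].

Definition down0 (t : nat -> R) : Prop := (forall k, 0 < t k) /\ t @ \oo --> (0 : R).

Definition tcone n (S : set 'rV[R]_n) (x : 'rV[R]_n) : set 'rV[R]_n :=
  [set d | exists (t : nat -> R) (dk : nat -> 'rV[R]_n),
     [/\ down0 t, dk @ \oo --> d & forall k, S (x + t k *: dk k)]].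

Definition tcone2 n (S : set 'rV[R]_n) (y v : 'rV[R]_n) : set 'rV[R]_n :=
  [set w | exists (t : nat -> R) (wk : nat -> 'rV[R]_n),
     [/\ down0 t, wk @ \oo --> w &
         forall k, S (y + t k *: v + (2^-1 * t k ^+ 2) *: wk k)]].

Definition tcone2a n (S : set 'rV[R]_n) (y v : 'rV[R]_n) : set 'rV[R]_n :=
  [set w | exists (t r : nat -> R) (wk : nat -> 'rV[R]_n),
     [/\ down0 t, down0 r, (fun k => t k / r k) @ \oo --> (0 : R),
         wk @ \oo --> w &
         forall k, S (y + t k *: v + (2^-1 * t k * r k) *: wk k)]].

(* regular (Frechet) normal cone; empty outside S *)
Definition rnormal n (S : set 'rV[R]_n) (y : 'rV[R]_n) : set 'rV[R]_n :=
  [set v | S y /\ forall e : R, 0 < e -> exists2 delta : R, 0 < delta &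
     forall y', S y' -> enorm (y' - y) < delta ->
       dotp v (y' - y) <= e * enorm (y' - y)].

Definition lnormal n (S : set 'rV[R]_n) (y : 'rV[R]_n) : set 'rV[R]_n :=
  [set v | exists (yk vk : nat -> 'rV[R]_n),
     [/\ forall k, S (yk k), yk @ \oo --> y, vk @ \oo --> v &
         forall k, rnormal S (yk k) (vk k)]].

Definition dnormal n (S : set 'rV[R]_n) (y u : 'rV[R]_n) : set 'rV[R]_n :=
  [set v | exists (t : nat -> R) (uk vk : nat -> 'rV[R]_n),
     [/\ down0 t, uk @ \oo --> u, vk @ \oo --> v &
         forall k, rnormal S (y + t k *: uk k) (vk k)]].

Definition supportf n (S : set 'rV[R]_n) (l : 'rV[R]_n) : \bar R :=
  ereal_sup [set (dotp l u)%:E | u in S].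

(* distance to a set, extended-real valued (+oo for the empty set) *)
Definition setdist n (x : 'rV[R]_n) (S : set 'rV[R]_n) : \bar R :=
  ereal_inf [set (enorm (x - y))%:E | y in S].

Definition Vdir n (rho delta : R) (d : 'rV[R]_n) : set 'rV[R]_n :=
  [set w | enorm w <= delta /\
     enorm (enorm d *: w - enorm w *: d) <= rho * enorm w * enorm d].

End Defs.

(* Main.v *)
Require Import Defs.
From HB Require Import structures.
From mathcomp Require Import all_boot all_order all_algebra.
From mathcomp Require Import all_classical all_reals all_analysis.
From mathcomp Require Import ring lra.
Import Order.TTheory GRing.Theory Num.Theory.
Import numFieldNormedType.Exports.
Local Open Scope classical_set_scope.
Local Open Scope ring_scope.
Set Implicit Arguments. Unset Strict Implicit. Unset Printing Implicit Defensive.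

(**
Both second-order tangent sets are limits of the blow-ups of the set along
curves y + t v + (t r / 2) w, with t / r -> 0 and t / r -> 1 respectively, so one
family [tconer th] treats (a) and (b) at once.  A second-order expansion turns
directional MSCQ into a global error bound for the linearized constraint
w A + th q \in tconer th K, and directional optimality into a lower bound for the
linearized objective.  The error bound makes a quadratic penalty exact, which
yields a multiplier as a limit of proximal normals of tconer th K; projecting
onto the blow-ups shows that such normals are directional limiting normals of K.
In (b) the infimum need not be attained, hence the minimizers of the
Tikhonov-regularized problem.  The bounds on the support functions are then
consequences of the stationarity equation alone.
*)

(** * Euclidean geometry of row vectors *)

Section Euclid.
Variable R : realType.
Implicit Types n m : nat.

Lemma dotpC n (u v : 'rV[R]_n) : dotp u v = dotp v u.
Proof. by apply: eq_bigr => i _; rewrite mulrC. Qed.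

Lemma dotpDl n (u v w : 'rV[R]_n) : dotp (u + v) w = dotp u w + dotp v w.
Proof. by rewrite -big_split; apply: eq_bigr => i _; rewrite mxE mulrDl. Qed.

Lemma dotpZl n (a : R) (u w : 'rV[R]_n) : dotp (a *: u) w = a * dotp u w.
Proof. by rewrite [RHS]mulr_sumr; apply: eq_bigr => i _; rewrite mxE mulrA. Qed.

Lemma dotpNl n (u w : 'rV[R]_n) : dotp (- u) w = - dotp u w.
Proof. by rewrite -scaleN1r dotpZl mulN1r. Qed.

Lemma dotpBl n (u v w : 'rV[R]_n) : dotp (u - v) w = dotp u w - dotp v w.
Proof. by rewrite dotpDl dotpNl. Qed.

Lemma dotpDr n (u v w : 'rV[R]_n) : dotp w (u + v) = dotp w u + dotp w v.
Proof. by rewrite !(dotpC w) dotpDl. Qed.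

Lemma dotpZr n (a : R) (u w : 'rV[R]_n) : dotp w (a *: u) = a * dotp w u.
Proof. by rewrite !(dotpC w) dotpZl. Qed.

Lemma dotpNr n (u w : 'rV[R]_n) : dotp w (- u) = - dotp w u.
Proof. by rewrite !(dotpC w) dotpNl. Qed.

Lemma dotpBr n (u v w : 'rV[R]_n) : dotp w (u - v) = dotp w u - dotp w v.
Proof. by rewrite dotpDr dotpNr. Qed.

Lemma dotp0l n (w : 'rV[R]_n) : dotp 0 w = 0.
Proof. by rewrite -(scale0r w) dotpZl mul0r. Qed.

Lemma dotp0r n (w : 'rV[R]_n) : dotp w 0 = 0.
Proof. by rewrite dotpC dotp0l. Qed.

Lemma dotpE n (u v : 'rV[R]_n) : dotp u v = (u *m v^T) ord0 ord0.
Proof. by rewrite mxE; apply: eq_bigr => i _; rewrite mxE. Qed.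

Lemma dotp_mulmxl n m (u : 'rV[R]_n) (A : 'M[R]_(n, m)) v :
  dotp (u *m A) v = dotp u (v *m A^T).
Proof. by rewrite !dotpE trmx_mul trmxK mulmxA. Qed.

Lemma quadfE n (H : 'M[R]_n) d : quadf H d = dotp (d *m H^T) d.
Proof. by rewrite dotp_mulmxl trmxK dotpC dotpE. Qed.

Lemma quadfZ n (H : 'M[R]_n) (a : R) d : quadf H (a *: d) = a ^+ 2 * quadf H d.
Proof. by rewrite !quadfE -scalemxAl dotpZl dotpZr mulrA. Qed.

Lemma dotp_ge0 n (u : 'rV[R]_n) : 0 <= dotp u u.
Proof. by apply: sumr_ge0 => i _; rewrite -expr2 sqr_ge0. Qed.

Lemma enorm_ge0 n (u : 'rV[R]_n) : 0 <= enorm u.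
Proof. exact: sqrtr_ge0. Qed.

Lemma sqr_enorm n (u : 'rV[R]_n) : enorm u ^+ 2 = dotp u u.
Proof. by rewrite sqr_sqrtr ?dotp_ge0. Qed.

Lemma coord_le_enorm n (u : 'rV[R]_n) i : `|u ord0 i| <= enorm u.
Proof.
rewrite -(ler_pXn2r (n := 2)) ?nnegrE ?enorm_ge0// sqr_enorm real_normK ?num_real//.
rewrite /dotp (bigD1 i)//= expr2 lerDl; apply: sumr_ge0 => j _.
by rewrite -expr2 sqr_ge0.
Qed.

Lemma enorm0 n : enorm (0 : 'rV[R]_n) = 0.
Proof. by rewrite /enorm dotp0l sqrtr0. Qed.

Lemma enorm0_eq0 n (u : 'rV[R]_n) : enorm u = 0 -> u = 0.
Proof.
move=> u0; apply/rowP => i; rewrite mxE; apply/eqP.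
by have := coord_le_enorm u i; rewrite u0 normr_le0.
Qed.

Lemma enormZ n (a : R) (u : 'rV[R]_n) : enorm (a *: u) = `|a| * enorm u.
Proof.
by rewrite /enorm dotpZl dotpZr mulrA -expr2 sqrtrM ?sqr_ge0// sqrtr_sqr.
Qed.

Lemma enormN n (u : 'rV[R]_n) : enorm (- u) = enorm u.
Proof. by rewrite -scaleN1r enormZ normrN1 mul1r. Qed.

Lemma enormC n (u v : 'rV[R]_n) : enorm (u - v) = enorm (v - u).
Proof. by rewrite -opprB enormN. Qed.

Lemma dotp_le_enorm n (u v : 'rV[R]_n) : dotp u v <= enorm u * enorm v.
Proof.
have [/enorm0_eq0->|v0] := eqVneq (enorm v) 0.
  by rewrite dotp0r mulr_ge0 ?enorm_ge0.
have vp : 0 < enorm v by rewrite lt_def v0 enorm_ge0.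
(* Up to the factor |v|^2 this is the component of u orthogonal to v; its squared norm is |v|^2
   (|u|^2 |v|^2 - <u,v>^2). *)
have := dotp_ge0 (enorm v ^+ 2 *: u - dotp u v *: v).
rewrite !(dotpBl, dotpBr, dotpZl, dotpZr) -!sqr_enorm (dotpC v u).
set a := enorm u; set b := enorm v; set c := dotp u v => h.
have a0 : 0 <= a := enorm_ge0 _.
have {}h : 0 <= b ^+ 2 * ((a * b) ^+ 2 - c ^+ 2) by lra.
have b2 : 0 < b ^+ 2 by rewrite exprn_gt0.
move: h; rewrite pmulr_rge0// subr_ge0 => h.
apply: le_trans (ler_norm _) _.
rewrite -(ler_pXn2r (n := 2)) ?nnegrE ?mulr_ge0 ?(ltW vp)//.
by rewrite real_normK ?num_real.
Qed.

Lemma norm_dotp_le n (u v : 'rV[R]_n) : `|dotp u v| <= enorm u * enorm v.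
Proof.
rewrite ler_norml dotp_le_enorm andbT lerNl -dotpNl -(enormN u).
exact: dotp_le_enorm.
Qed.

Lemma enormD n (u v : 'rV[R]_n) : enorm (u + v) <= enorm u + enorm v.
Proof.
rewrite -(ler_pXn2r (n := 2)) ?nnegrE ?addr_ge0 ?enorm_ge0//.
rewrite sqr_enorm !(dotpDl, dotpDr) (dotpC v u) -!sqr_enorm.
have := dotp_le_enorm u v; lra.
Qed.

Lemma enormB n (u v : 'rV[R]_n) : enorm (u - v) <= enorm u + enorm v.
Proof. by rewrite -(enormN v) enormD. Qed.

Lemma enorm_triangle n (v u w : 'rV[R]_n) :
  enorm (u - w) <= enorm (u - v) + enorm (v - w).
Proof. by rewrite -[u - w](subrKA v) enormD. Qed.

Lemma ler_enorm_dist n (u v : 'rV[R]_n) : `|enorm u - enorm v| <= enorm (u - v).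
Proof.
rewrite ler_distl; have := enormD (u - v) v; have := enormD (v - u) u.
rewrite !subrK (enormC v); lra.
Qed.

(** The topology of row vectors comes from the max norm; this bound and [norm_le_enorm] carry limits
    over to the Euclidean norm and back. *)
Lemma enorm_le_norm n (u : 'rV[R]_n) : enorm u <= n%:R * `|u|.
Proof.
have h i : `|u ord0 i| <= `|u|.
  rewrite [leRHS]/Num.norm /= mx_normrE; apply/bigmax_geP; right.
  by exists (ord0, i).
rewrite -(ler_pXn2r (n := 2)) ?nnegrE ?mulr_ge0 ?enorm_ge0//.
rewrite sqr_enorm exprMn.
apply: (@le_trans _ _ (n%:R * `|u| ^+ 2)).
  apply: (@le_trans _ _ (\sum_(i < n) `|u| ^+ 2)).
    apply: ler_sum => i _; rewrite -expr2 -[leLHS]real_normK ?num_real//.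
    by rewrite ler_pXn2r ?nnegrE.
  by rewrite sumr_const card_ord mulr_natl.
rewrite ler_wpM2r ?sqr_ge0// expr2.
by case: n {u h} => [|n]; rewrite ?mulr0// ler_peMr// ler1n.
Qed.

Lemma norm_le_enorm n (u : 'rV[R]_n) : `|u| <= enorm u.
Proof.
rewrite [leLHS]/Num.norm /= mx_normrE; apply/bigmax_leP; split.
  exact: enorm_ge0.
by move=> [i j] _ /=; rewrite (ord1 i) coord_le_enorm.
Qed.

Lemma dotp_continuous n T (F : set_system T) {FF : Filter F}
    (u v : T -> 'rV[R]_n) a b :
  u @ F --> a -> v @ F --> b -> (fun x => dotp (u x) (v x)) @ F --> dotp a b.
Proof.
move=> ua vb; rewrite /dotp.
apply: cvg_big => [|i _]; first exact: add_continuous.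
by apply: cvgM; apply: (@cvg_comp _ _ _ _ (fun M : 'rV[R]_n => M ord0 i) _ _ _ _
  (@coord_continuous _ _ _ _ _ _)).
Qed.
End Euclid.

(** * Convergence, cluster points and existence of minimizers *)

Section Topology.
Variable R : realType.
Implicit Types n m : nat.

Lemma cvg_ext T (U : topologicalType) (F : set_system T) (f g : T -> U)
    (l l' : U) : g =1 f -> l' = l -> f @ F --> l -> g @ F --> l'.
Proof. by move=> /funext -> ->. Qed.

Lemma cvg_enorm_lt n T (F : set_system T) {FF : Filter F} (u : T -> 'rV[R]_n)
    (a : 'rV[R]_n) (e : R) :
  u @ F --> a -> 0 < e -> \forall x \near F, enorm (u x - a) < e.
Proof.
(* Dividing by n + 1 instead of n covers dimension 0. *)
move=> ua e0; have e1 : 0 < e / n.+1%:R by rewrite divr_gt0.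
near=> x; apply: le_lt_trans (enorm_le_norm _) _.
have h : `|u x - a| < e / n.+1%:R.
  by rewrite distrC; near: x; exact: (cvgr_dist_lt _ _ ua).
have n1 : n%:R * `|u x - a| <= n.+1%:R * `|u x - a|.
  by rewrite ler_wpM2r// ler_nat.
by apply: le_lt_trans n1 _; rewrite mulrC -ltr_pdivlMr.
Unshelve. all: by end_near. Qed.

Lemma enorm_lt_cvg n T (F : set_system T) {FF : Filter F} (u : T -> 'rV[R]_n)
    (a : 'rV[R]_n) :
  (forall e, 0 < e -> \forall x \near F, enorm (u x - a) < e) -> u @ F --> a.
Proof.
move=> h; apply/cvgrPdist_lt => e e0; near=> x.
rewrite distrC; apply: le_lt_trans (norm_le_enorm _) _; near: x; exact: h.
Unshelve. all: by end_near. Qed.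

Lemma enorm_continuous n T (F : set_system T) {FF : Filter F}
    (u : T -> 'rV[R]_n) (a : 'rV[R]_n) :
  u @ F --> a -> (fun x => enorm (u x)) @ F --> enorm a.
Proof.
move=> ua; apply/cvgrPdist_lt => e e0; near=> x.
rewrite distrC; apply: le_lt_trans (ler_enorm_dist _ _) _.
near: x; exact: cvg_enorm_lt.
Unshelve. all: by end_near. Qed.

Lemma cvg_row n T (F : set_system T) {FF : Filter F} (u : T -> 'rV[R]_n)
    (a : 'rV[R]_n) :
  (forall i, (fun x => u x ord0 i) @ F --> a ord0 i) -> u @ F --> a.
Proof.
move=> h; rewrite (row_sum_delta a).
under eq_cvg do rewrite (row_sum_delta (u _)).
apply: cvg_big => [|i _]; first exact: add_continuous.
by apply: cvgZr_tmp; exact: h.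
Qed.

Lemma mulmx_continuous n m T (F : set_system T) {FF : Filter F}
    (u : T -> 'rV[R]_n) (a : 'rV[R]_n) (A : 'M[R]_(n, m)) :
  u @ F --> a -> (fun x => u x *m A) @ F --> a *m A.
Proof.
move=> ua; apply: cvg_row => i.
have E b : (b *m A) ord0 i = dotp b (row i A^T).
  by rewrite mxE; apply: eq_bigr => j _; rewrite !mxE.
by under eq_cvg do rewrite E; rewrite E; apply: dotp_continuous => //; exact: cvg_cst.
Qed.

Lemma quadf_continuous n T (F : set_system T) {FF : Filter F}
    (u : T -> 'rV[R]_n) (a : 'rV[R]_n) (H : 'M[R]_n) :
  u @ F --> a -> (fun x => quadf H (u x)) @ F --> quadf H a.
Proof.
move=> ua; under eq_cvg do rewrite quadfE; rewrite quadfE.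
by apply: dotp_continuous => //; exact: mulmx_continuous.
Qed.

Lemma nbhs_eball n (x : 'rV[R]_n) (e : R) :
  0 < e -> nbhs x [set y | enorm (y - x) < e].
Proof.
move=> e0; have : id @ nbhs x --> x by [].
by move=> /(@cvg_enorm_lt _ _ (nbhs x) _)/(_ e0).
Qed.

Lemma adherent_closed n (S : set 'rV[R]_n) :
  (forall x, (forall e, 0 < e -> exists2 y, S y & enorm (y - x) < e) -> S x) ->
  closed S.
Proof.
move=> h x clx; apply: h => e e0.
by have /clx[y [Sy ye]] := nbhs_eball x e0; exists y.
Qed.

Lemma bounded_cluster n (x : nat -> 'rV[R]_n) B :
  (forall k, enorm (x k) <= B) ->
  exists l, forall e N, 0 < e -> exists2 k, (N <= k)%N & enorm (x k - l) < e.
Proof.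
move=> xB.
have cS : compact [set y : 'rV[R]_n | `|y| <= B].
  apply: bounded_closed_compact.
    exists B; split; first exact: num_real.
    by move=> M /ltW BM y /= /le_trans; apply.
  by apply: (@closed_comp _ _ (fun y : 'rV[R]_n => `|y|) [set r : R | r <= B]);
    [move=> y _; exact: norm_continuous|exact: closed_le].
have [|l [_ lx]] := cS (x @ \oo) _.
  by exists 0%N => // k _ /=; exact: le_trans (norm_le_enorm _) (xB k).
exists l => e N e0.
have hN : (x @ \oo) [set y | exists2 k, (N <= k)%N & y = x k].
  by exists N => // k /= Nk; exists k.
by have [y [[k Nk ->] ?]] := lx _ _ hN (nbhs_eball l e0); exists k.
Qed.

(** Replaces extraction of subsequences: objects exist at every scale e, only their image under [pi]
    is bounded, and the limit is approached along scales tending to 0. As [P] need not be monotone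
    in e, the scale e' reached is returned. *)
Lemma bounded_cluster_scale X n (P : R -> X -> Prop) (pi : X -> 'rV[R]_n) B :
  (forall e, 0 < e -> exists x, P e x) ->
  (forall e x, e <= 1 -> P e x -> enorm (pi x) <= B) ->
  exists l, forall e, 0 < e ->
    exists e' x, [/\ e' < e, P e' x & enorm (pi x - l) < e].
Proof.
move=> exP PB.
have /choice[x Px] : forall k : nat, exists x, P k.+1%:R^-1 x.
  by move=> k; apply: exP; rewrite invr_gt0.
have [|l hl] := @bounded_cluster n (pi \o x) B.
  by move=> k; apply: PB (Px k); rewrite invf_le1 ?ler1n.
exists l => e e0; have [N _ hN] := near_infty_natSinv_lt (PosNum e0).
have [k Nk xl] := hl e N e0; exists k.+1%:R^-1, (x k); split=> //.
exact: hN.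
Qed.

Lemma compact_ebounded n (S : set 'rV[R]_n) B :
  closed S -> (forall y, S y -> enorm y <= B) -> compact S.
Proof.
move=> cS SB; apply: bounded_closed_compact => //.
exists B; split; first exact: num_real.
move=> M /ltW BM y /SB yB; apply: le_trans (norm_le_enorm _) _.
exact: le_trans yB BM.
Qed.

Lemma closed_eball n (a : 'rV[R]_n) B : closed [set y | enorm (y - a) <= B].
Proof.
apply: adherent_closed => x h /=; apply/ler_addgt0Pr => e e0.
have [y /= yB yx] := h _ e0; have := enorm_triangle y x a.
rewrite (enormC x y); lra.
Qed.

Lemma compact_min (T : topologicalType) (A : set T) (f : T -> R) :
  compact A -> A !=set0 -> continuous f ->
  exists2 a, A a & forall b, A b -> f a <= f b.
Proof.
move=> cA A0 cf.
have [|a aA h] := compact_EVT_min A0 cA (f := f).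
  by apply: continuous_subspaceT => x; exact: cf.
by rewrite inE in aA; exists a => // b bA; apply: h; rewrite inE.
Qed.

(** The sublevel set of the reference point lies in a compact product; outside it f exceeds its
    reference value, so the minimum over the product is global. *)
Lemma coercive_min2 n m (D : set 'rV[R]_m) (f : 'rV[R]_n -> 'rV[R]_m -> R) z0 u0 B :
  closed D -> D u0 -> continuous (fun p : 'rV[R]_n * 'rV[R]_m => f p.1 p.2) ->
  (forall z u, D u -> f z u <= f z0 u0 -> enorm (z - z0) <= B /\ enorm (u - u0) <= B) ->
  exists z u, D u /\ forall z' u', D u' -> f z u <= f z' u'.
Proof.
move=> cD Du0 cf coer.
pose A1 := [set z : 'rV[R]_n | enorm (z - z0) <= B].
pose A2 := D `&` [set u | enorm (u - u0) <= B].
have cA1 : compact A1.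
  apply: (@compact_ebounded _ _ (B + enorm z0)); first exact: closed_eball.
  by move=> y yB; rewrite -[y](subrK z0) (le_trans (enormD _ _))// lerD2r.
have cA2 : compact A2.
  apply: (@compact_ebounded _ _ (B + enorm u0)).
    by apply: closedI => //; exact: closed_eball.
  by move=> y [_ yB]; rewrite -[y](subrK u0) (le_trans (enormD _ _))// lerD2r.
have [zB uB] := coer z0 u0 Du0 (lexx _).
have [|[z u] [/= zA [Du uA]] h] := compact_min (compact_setX cA1 cA2) _ cf.
  by exists (z0, u0); split.
exists z, u; split=> // z' u' Du'.
have [le0|/ltW gt0] := leP (f z' u') (f z0 u0).
  by have [? ?] := coer _ _ Du' le0; apply: (h (z', u')).
by apply: le_trans gt0; apply: (h (z0, u0)).
Qed.

Lemma coercive_min n (S : set 'rV[R]_n) (f : 'rV[R]_n -> R) x0 B :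
  closed S -> S x0 -> continuous f ->
  (forall x, S x -> f x <= f x0 -> enorm (x - x0) <= B) ->
  exists2 x, S x & forall y, S y -> f x <= f y.
Proof.
move=> cS Sx0 cf coer.
pose A := S `&` [set x | enorm (x - x0) <= B].
have cA : compact A.
  apply: (@compact_ebounded _ _ (B + enorm x0)).
    by apply: closedI => //; exact: closed_eball.
  by move=> y [_ yB]; rewrite -[y](subrK x0) (le_trans (enormD _ _))// lerD2r.
have Ax0 : A x0 by split=> //; exact: coer.
have [|x [Sx _] h] := compact_min cA _ cf; first by exists x0.
exists x => // y Sy; have [le0|/ltW gt0] := leP (f y) (f x0).
  by apply: h; split=> //; exact: coer.
by apply: le_trans gt0; exact: h.
Qed.
End Topology.

(** * Second-order expansions along converging directions *)

Section Taylor.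
Variable R : realType.
Implicit Types n m : nat.

Lemma is_derive_line n (F : 'rV[R]_n -> R) (G : 'rV[R]_n -> 'rV[R]_n)
    (x h : 'rV[R]_n) (s : R) :
  (forall y, differentiable F y /\
    ('d F y : 'rV[R]_n -> R) =1 (fun v => dotp (G y) v)) ->
  is_derive s 1 (fun r : R => F (x + r *: h)) (dotp (G (x + s *: h)) h).
Proof.
move=> dF; set y := x + s *: h; have [dy Ey] := dF y.
have E : (fun e : R => e^-1 *: (F (x + (e *: (1 : R) + s) *: h) - F y)) =
         (fun e : R => e^-1 *: (F (e *: h + y) - F y)).
  apply/funext => e; congr (_ *: (F _ - _)).
  by rewrite scalerDl /y addrCA -[e *: 1]/(e * 1) mulr1.
have := diff_derivable (v := h) dy; rewrite /derivable => dh.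
split; first by rewrite /derivable /= E.
by rewrite /derive /= E -[LHS]/('D_h F y) deriveE// Ey.
Qed.

Lemma differentiable_enorm n m (G : 'rV[R]_n -> 'rV[R]_m) x (A : 'M[R]_(n, m)) :
  differentiable G x -> ('d G x : 'rV[R]_n -> 'rV[R]_m) =1 (fun v => v *m A) ->
  forall e : R, 0 < e -> exists2 r : R, 0 < r & forall h, enorm h < r ->
    enorm (G (x + h) - G x - h *m A) <= e * enorm h.
Proof.
move=> dG EG e e0.
have e1 : 0 < e / m.+1%:R by rewrite divr_gt0.
have := diff_locally dG => /eqaddoP/(_ _ e1)/nbhs_ballP[r /= r0 rB].
exists r => // h hr.
have {}hr : ball (0 : 'rV[R]_n) r h.
  by rewrite -ball_normE /ball_ /= sub0r normrN; exact: le_lt_trans (norm_le_enorm _) hr.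
have /= := rB _ hr; rewrite !fctE /= EG opprD addrA (addrC h x) => le.
apply: le_trans (enorm_le_norm _) _.
have le2 : m%:R * `|G (x + h) - G x - h *m A| <= m.+1%:R * (e / m.+1%:R * `|h|).
  by apply: ler_pM => //; rewrite ler_nat.
apply: le_trans le2 _; rewrite mulrA mulrCA divff// mulr1 ler_pM2l//.
exact: norm_le_enorm.
Qed.

(** The mean value theorem, applied to the remainder along the segment from x to x + h, reduces the
    estimate to the first-order expansion of the gradient at x. *)
Lemma taylor2 n (F : 'rV[R]_n -> R) G H x : C2 F G H ->
  forall e : R, 0 < e -> exists2 r : R, 0 < r & forall h, enorm h < r ->
    `|F (x + h) - F x - dotp (G x) h - 2^-1 * quadf (H x) h| <= e * enorm h ^+ 2.
Proof.
move=> [dF _ dG _] e e0; have [dGx EGx] := dG x.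
have [r r0 hr] := differentiable_enorm dGx EGx e0.
exists r => // h hhr.
pose f (s : R) := F (x + s *: h) - s * dotp (G x) h - s ^+ 2 * (2^-1 * quadf (H x) h).
pose df (s : R) := dotp (G (x + s *: h)) h - dotp (G x) h - s * quadf (H x) h.
have Df (s : R) : is_derive s 1 f (df s).
  have D1 := is_derive_line x h s dF.
  have E : f = (fun r : R => F (x + r *: h)) - dotp (G x) h \*: (@id R)
             - (2^-1 * quadf (H x) h) \*: ((@id R) ^+ 2).
    by apply/funext => t; rewrite /f !fctE /= /GRing.scale /=; ring.
  rewrite E; apply: is_derive_eq; rewrite /df /GRing.scale /=.
  by field.
have [|c] := @MVT R f df 0 1 ltr01 (fun s _ => Df s).
  apply: continuous_subspaceT => s; apply: differentiable_continuous.
  by apply/derivable1_diffP; exact: ex_derive.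
rewrite in_itv/= => /andP[c0 c1].
rewrite subr0 mulr1 /f /df !scale1r !scale0r addr0.
rewrite expr0n expr1n !mul0r !mul1r !subr0 => E.
rewrite [X in `|X|](_ : _ = dotp (G (x + c *: h) - G x - (c *: h) *m (H x)^T) h); last first.
  by rewrite !dotpBl -scalemxAl dotpZl -quadfE; lra.
have nc : enorm (c *: h) = c * enorm h by rewrite enormZ gtr0_norm.
have hc : enorm (c *: h) < r.
  rewrite nc; apply: le_lt_trans hhr.
  by rewrite ler_piMl ?enorm_ge0// ltW.
apply: le_trans (norm_dotp_le _ _) _.
have := hr _ hc; rewrite nc => le1.
rewrite expr2 mulrA ler_wpM2r ?enorm_ge0//; apply: le_trans le1 _.
by rewrite ler_pM2l// ler_piMl ?enorm_ge0// ltW.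
Qed.

(** The linear term keeps the moving direction [dk k]: replacing it by d would cost t |dk - d|,
    which need not be o(t^2). *)
Lemma taylor2_seq n (F : 'rV[R]_n -> R) G H x (t : nat -> R)
    (dk : nat -> 'rV[R]_n) d : C2 F G H -> down0 t -> dk @ \oo --> d ->
  (fun k => (t k ^+ 2)^-1 * (F (x + t k *: dk k) - F x - t k * dotp (G x) (dk k)))
    @ \oo --> 2^-1 * quadf (H x) d.
Proof.
move=> hC [t0 tt] dd.
have hn : (fun k => enorm (dk k)) @ \oo --> enorm d by exact: enorm_continuous.
have hq : (fun k => 2^-1 * quadf (H x) (dk k)) @ \oo --> 2^-1 * quadf (H x) d.
  by apply: cvgM; [exact: cvg_cst|exact: quadf_continuous].
have h0 : (fun k => enorm (t k *: dk k)) @ \oo --> (0 : R).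
  rewrite -(enorm0 R n); apply: enorm_continuous; rewrite -(scale0r d).
  exact: cvgZ.
suff hs : (fun k => (t k ^+ 2)^-1 * (F (x + t k *: dk k) - F x - t k * dotp (G x) (dk k))
    - 2^-1 * quadf (H x) (dk k)) @ \oo --> (0 : R).
  by refine (cvg_ext _ _ (cvgD hs hq)) => [k|]; rewrite ?add0r// fctE subrK.
apply/cvgr0Pnorm_lt => e e0.
pose B := (enorm d + 1) ^+ 2.
have B0 : 0 < B by rewrite exprn_gt0// ltr_wpDl// enorm_ge0.
have e1 : 0 < e / (B + 1) by rewrite divr_gt0// addr_gt0.
have [r r0 hr] := taylor2 x hC e1.
near=> k.
have tk := t0 k.
have hk : enorm (t k *: dk k) < r.
  by near: k; exact: (cvgr_lt _ h0).
have nk : enorm (dk k) < enorm d + 1.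
  by near: k; apply: (cvgr_lt _ hn); rewrite ltrDl.
have := hr _ hk; rewrite dotpZr quadfZ enormZ (gtr0_norm tk) exprMn => le.
have t2 : 0 < t k ^+ 2 by rewrite exprn_gt0.
rewrite [X in `|X|](_ : _ = (t k ^+ 2)^-1 * (F (x + t k *: dk k) - F x
   - t k * dotp (G x) (dk k) - 2^-1 * (t k ^+ 2 * quadf (H x) (dk k)))); last first.
  by field; rewrite gt_eqF.
rewrite normrM [`|_^-1|]gtr0_norm ?invr_gt0// mulrC ltr_pdivrMr//.
apply: le_lt_trans le _.
have le2 : enorm (dk k) ^+ 2 <= B.
  by rewrite ler_pXn2r ?nnegrE ?enorm_ge0 ?addr_ge0 ?enorm_ge0// ltW.
rewrite mulrCA [ltRHS]mulrC ltr_pM2l// mulrAC ltr_pdivrMr ?addr_gt0// ltr_pM2l//.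
by rewrite (le_lt_trans le2)// ltrDl.
Unshelve. all: by end_near. Qed.
End Taylor.

(** * Exact penalization and multipliers of linearized constraints *)

Section Multiplier.
Variable R : realType.
Implicit Types n m : nat.

(** Proximal normals, with the quadratic inequality on all of S, the form in which minimization and
    projection deliver it. *)
Definition pnormal n (S : set 'rV[R]_n) (y : 'rV[R]_n) : set 'rV[R]_n :=
  [set v | S y /\ exists2 M : R, 0 < M &
     forall y', S y' -> dotp v (y' - y) <= M * enorm (y' - y) ^+ 2].

Lemma pnormal_rnormal n (S : set 'rV[R]_n) y : pnormal S y `<=` rnormal S y.
Proof.
move=> v [Sy [M M0 h]]; split=> // e e0.
exists (e / M); first by rewrite divr_gt0.
move=> y' Sy' yy'; apply: le_trans (h _ Sy') _.
rewrite expr2 mulrA ler_wpM2r ?enorm_ge0// mulrC -ler_pdivlMr//.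
exact: ltW.
Qed.

Lemma mulmx_bounded n m (A : 'M[R]_(n, m)) :
  exists2 a : R, 0 <= a & forall v, enorm (v *m A) <= a * enorm v.
Proof.
exists (\sum_i enorm (row i A)).
  by apply: sumr_ge0 => i _; exact: enorm_ge0.
move=> v; rewrite mulmx_sum_row.
have tri I (r : seq I) (f : I -> 'rV[R]_m) :
    enorm (\sum_(i <- r) f i) <= \sum_(i <- r) enorm (f i).
  elim: r => [|i r ih]; first by rewrite !big_nil enorm0.
  by rewrite !big_cons (le_trans (enormD _ _))// lerD2l.
apply: le_trans (tri _ _ _) _; rewrite mulr_suml; apply: ler_sum => i _.
by rewrite enormZ mulrC ler_wpM2l ?enorm_ge0// coord_le_enorm.
Qed.

Lemma quad_nonneg_lin0 n (p : 'rV[R]_n) (Q : R) : 0 <= Q ->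
  (forall h, 0 <= dotp p h + Q * enorm h ^+ 2) -> p = 0.
Proof.
move=> Q0 h; apply: enorm0_eq0; apply/eqP.
have Q1 : 0 < Q + 1 by lra.
(* Testing with h = - s p gives the value - s^2 |p|^2, which must be nonnegative. *)
pose s := (Q + 1)^-1; have s0 : 0 < s by rewrite invr_gt0.
have := h (- s *: p); rewrite dotpZr enormZ exprMn real_normK ?num_real//.
rewrite -sqr_enorm sqrrN.
have -> : - s * enorm p ^+ 2 + Q * (s ^+ 2 * enorm p ^+ 2) = - (s ^+ 2 * enorm p ^+ 2).
  by rewrite /s; field; rewrite gt_eqF.
rewrite oppr_ge0 pmulr_rle0 ?exprn_gt0// => le0.
by rewrite -sqrf_eq0 eq_le le0 sqr_ge0.
Qed.

(* Arithmetic of the exact penalty: s is the infeasibility, zn and zn' are the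
   norms of a point and of a feasible point within distance ka * s of it. *)
Lemma penalty_lower_bound (ka M nc k s zn zn' un cz cz' : R) :
  0 <= ka -> 0 <= M -> 0 <= s -> 0 <= zn -> 0 <= zn' ->
  4 * (4 * (M * ka) ^+ 2 + M * ka ^+ 2) <= k ->
  0 <= cz' + M * zn' ^+ 2 -> cz' - cz <= nc * (ka * s) -> zn' <= zn + ka * s ->
  k / 4 * s ^+ 2 + zn ^+ 2 / 4 + un ^+ 2 / 2 - ka * nc * s <=
  cz + M * zn ^+ 2 + k / 2 * s ^+ 2 + zn ^+ 2 / 2 + un ^+ 2 / 2.
Proof.
move=> ka0 M0 s0 zn0 zn'0 hk opt hc hz.
have h1 : zn' ^+ 2 <= (zn + ka * s) ^+ 2.
  by rewrite ler_pXn2r ?nnegrE// addr_ge0// mulr_ge0.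
have h2 : M * zn' ^+ 2 <= M * (zn + ka * s) ^+ 2 by rewrite ler_wpM2l.
(* Young's inequality splits the cross term 2 M ka zn s into zn^2 / 4 and a multiple of s^2; the
   latter is absorbed by a quarter of k s^2. *)
have h3 : 0 <= (zn / 2 - 2 * (M * ka) * s) ^+ 2 by rewrite sqr_ge0.
have h4 : 4 * (4 * (M * ka) ^+ 2 + M * ka ^+ 2) * s ^+ 2 <= k * s ^+ 2.
  by rewrite ler_wpM2r// sqr_ge0.
lra.
Qed.

(** Decouple the constraint: minimize over free z and over u in D, with the quadratic penalty (k /
    2) |ub + z A - u|^2 and localizing terms that keep (z, u) near (0, ub). Minimality in z yields
    stationarity, minimality in u yields a proximal normal of D, and the error bound keeps k times
    the residual bounded independently of k. *)
Lemma approximate_multiplier n m (A : 'M[R]_(n, m)) (D : set 'rV[R]_m) ub c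
    (ka M : R) : 0 <= ka -> 0 <= M -> closed D -> D ub ->
  (forall z u, D u -> exists2 z', D (ub + z' *m A) &
     enorm (z - z') <= ka * enorm (ub + z *m A - u)) ->
  (forall z, D (ub + z *m A) -> 0 <= dotp c z + M * enorm z ^+ 2) ->
  forall e : R, 0 < e -> exists u l, [/\ pnormal D u l, enorm (u - ub) < e,
    enorm (c + l *m A^T) < e & enorm l < 4 * ka * enorm c + e].
Proof.
move=> ka0 M0 cD Dub eb opt e e0.
have [a a0 ha] := mulmx_bounded A^T.
have [b b0 hb] := mulmx_bounded A.
set nc := enorm c; have nc0 : 0 <= nc := enorm_ge0 _.
(* The errors to be bounded are at most eta, (2 M + 1 + a) eta and eta, all below e. *)
pose eta := e / (2 * M + 2 + a).
have den0 : 0 < 2 * M + 2 + a by lra.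
have eta0 : 0 < eta by rewrite divr_gt0.
have eE : e = eta * (2 * M + 2 + a) by rewrite /eta divfK// gt_eqF.
pose P := 4 * (4 * (M * ka) ^+ 2 + M * ka ^+ 2).
have P0 : 0 <= P by rewrite !(mulr_ge0, addr_ge0, sqr_ge0).
(* [P] is the threshold of [penalty_lower_bound], the second term forces the minimizer within eta of
   (0, ub), and 1 makes k positive. *)
pose k := P + 16 * (ka * nc) ^+ 2 / eta ^+ 2 + 1.
have k'0 : 0 <= 16 * (ka * nc) ^+ 2 / eta ^+ 2.
  by rewrite !mulr_ge0 ?sqr_ge0 ?invr_ge0 ?sqr_ge0.
have k0 : 0 < k by rewrite /k; lra.
have kP : P <= k by rewrite /k; lra.
have ketal : 16 * (ka * nc) ^+ 2 <= k * eta ^+ 2.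
  rewrite -ler_pdivrMr ?exprn_gt0// /k; lra.
pose f z u := dotp c z + M * dotp z z
  + k / 2 * dotp (ub + z *m A - u) (ub + z *m A - u)
  + dotp z z / 2 + dotp (u - ub) (u - ub) / 2.
have f0 : f 0 ub = 0.
  by rewrite /f mul0mx addr0 subrr !dotp0l dotp0r; lra.
have sub z u : D u -> f z u <= f 0 ub ->
    [/\ k * enorm (ub + z *m A - u) <= 4 * ka * nc, enorm z <= eta & enorm (u - ub) <= eta].
  move=> Du; rewrite f0 /f -!sqr_enorm => le0.
  have [z' Dz' hz'] := eb z u Du.
  set s := enorm (ub + z *m A - u) in le0 hz' *.
  have s0 : 0 <= s := enorm_ge0 _.
  have hc : dotp c z' - dotp c z <= nc * (ka * s).
    rewrite -dotpBr; apply: le_trans (dotp_le_enorm _ _) _.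
    by rewrite ler_wpM2l// enormC.
  have hn : enorm z' <= enorm z + ka * s.
    by have := enorm_triangle z z' 0; rewrite !subr0 (enormC z'); lra.
  have := penalty_lower_bound (enorm (u - ub)) ka0 M0 s0 (enorm_ge0 z) (enorm_ge0 z')
    kP (opt _ Dz') hc hn.
  set zn := enorm z in le0 *; set un := enorm (u - ub) in le0 *.
  move=> le1.
  have z2 : 0 <= zn ^+ 2 by rewrite sqr_ge0.
  have u2 : 0 <= un ^+ 2 by rewrite sqr_ge0.
  (* On the sublevel set, (k / 4) s^2 <= ka nc s; divide by s. *)
  have ks : k * s <= 4 * ka * nc.
    have [s00|sn0] := eqVneq s 0.
      by rewrite s00 mulr0 !mulr_ge0.
    have sp : 0 < s by rewrite lt_def sn0.
    rewrite -(ler_pM2r sp); lra.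
  have kn0 : 0 <= ka * nc by rewrite mulr_ge0.
  have h2 : ka * nc * (k * s) <= ka * nc * (4 * ka * nc) by rewrite ler_wpM2l.
  have h3 : k * (zn ^+ 2 / 4 + un ^+ 2 / 2) <= k * (ka * nc * s).
    have ks2 : 0 <= k * s ^+ 2 by rewrite mulr_ge0 ?sqr_ge0// ltW.
    by rewrite ler_wpM2l ?(ltW k0)//; lra.
  have kz : 0 <= k * zn ^+ 2 by rewrite mulr_ge0// ltW.
  have ku : 0 <= k * un ^+ 2 by rewrite mulr_ge0// ltW.
  split=> //.
  - rewrite -(ler_pXn2r (n := 2)) ?nnegrE ?enorm_ge0 ?(ltW eta0)// -(ler_pM2l k0).
    apply: le_trans ketal; lra.
  - rewrite -(ler_pXn2r (n := 2)) ?nnegrE ?enorm_ge0 ?(ltW eta0)// -(ler_pM2l k0).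
    apply: le_trans ketal; lra.
have cf : continuous (fun p : 'rV[R]_n * 'rV[R]_m => f p.1 p.2).
  move=> p.
  have c1 : (fun q : 'rV[R]_n * 'rV[R]_m => q.1) @ p --> p.1 by exact: cvg_fst.
  have c2 : (fun q : 'rV[R]_n * 'rV[R]_m => q.2) @ p --> p.2 by exact: cvg_snd.
  have c3 : (fun q : 'rV[R]_n * 'rV[R]_m => ub + q.1 *m A - q.2) @ p --> ub + p.1 *m A - p.2.
    by apply: cvgB => //; apply: cvgD; [exact: cvg_cst|exact: mulmx_continuous].
  have c4 : (fun q : 'rV[R]_n * 'rV[R]_m => q.2 - ub) @ p --> p.2 - ub.
    by apply: cvgB => //; exact: cvg_cst.
  rewrite /f; repeat apply: cvgD; repeat apply: cvgM;
    by [exact: cvg_cst|apply: dotp_continuous => //; exact: cvg_cst].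
have [|z [u [Du hmin]]] := @coercive_min2 R n m D f 0 ub eta cD Dub cf.
  by move=> z u Du /(sub _ _ Du)[_ ? ?]; rewrite subr0.
have [ks zeta ueta] := sub _ _ Du (hmin _ _ Dub).
pose y := ub + z *m A - u.
(* Minus the gradient in u of the penalty and localizing terms. The function is quadratic in u with
   second derivative k + 1, whence the proximal constant (k + 1) / 2. *)
exists u, (k *: y - (u - ub)); split.
- split=> //; exists ((k + 1) / 2); first by lra.
  move=> u' Du'; have := hmin z u' Du'; rewrite /f.
  have -> : ub + z *m A - u' = y - (u' - u) by rewrite /y opprB addrA subrK.
  have -> : u' - ub = (u' - u) + (u - ub) by rewrite subrKA.
  rewrite -/y sqr_enorm; move: y (u' - u) (u - ub) => y w v.
  rewrite !(dotpBl, dotpBr, dotpDl, dotpDr, dotpZl) (dotpC w y) (dotpC w v); lra.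
- rewrite eE; apply: le_lt_trans ueta _; rewrite ltr_pMr//; lra.
- have -> : c + (k *: y - (u - ub)) *m A^T = - ((2 * M + 1) *: z + (u - ub) *m A^T).
    have p0 : c + (2 * M + 1) *: z + (k *: y) *m A^T = 0.
      (* Stationarity in z, read off from the increment of f; the constant bounds its part quadratic
         in h. *)
      apply: (@quad_nonneg_lin0 _ _ (M + 1 / 2 + k / 2 * b ^+ 2)) => [|h].
        have : 0 <= k * b ^+ 2 by rewrite mulr_ge0 ?sqr_ge0// ltW.
        lra.
      have := hmin (z + h) u Du; rewrite /f mulmxDl.
      have -> : ub + (z *m A + h *m A) - u = y + h *m A by rewrite /y addrA [LHS]addrAC.
      rewrite -/y; move: y => y.
      rewrite !(dotpDl, dotpDr, dotpZl) (dotp_mulmxl (k *: y)) trmxK dotpZl.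
      rewrite (dotpC h z) (dotpC _ y).
      have : dotp (h *m A) (h *m A) <= b ^+ 2 * enorm h ^+ 2.
        by rewrite -sqr_enorm -exprMn ler_pXn2r ?nnegrE ?mulr_ge0 ?enorm_ge0.
      have := dotp_ge0 h; rewrite -(sqr_enorm h) => h0 hA.
      have : k * dotp (h *m A) (h *m A) <= k * (b ^+ 2 * enorm h ^+ 2).
        by rewrite ler_wpM2l// ltW.
      lra.
    rewrite mulmxBl; apply/eqP; rewrite -subr_eq0 opprK -p0; apply/eqP.
    by rewrite addrACA subrK.
  rewrite enormN; apply: le_lt_trans (enormD _ _) _.
  have h1 : enorm ((u - ub) *m A^T) <= a * eta.
    by apply: le_trans (ha _) _; rewrite ler_wpM2l.
  have h2 : enorm ((2 * M + 1) *: z) <= (2 * M + 1) * eta.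
    by rewrite enormZ ger0_norm ?ler_wpM2l//; lra.
  rewrite eE; lra.
- apply: le_lt_trans (enormB _ _) _; rewrite enormZ gtr0_norm// eE.
  have : 0 < eta * (2 * M + 1 + a) by rewrite mulr_gt0//; lra.
  rewrite -/y in ks; lra.
Qed.

(** The norm bound on approximate multipliers is uniform for e <= 1, so they cluster as e tends to 0
    and stationarity becomes exact. *)
Lemma exact_multiplier n m (A : 'M[R]_(n, m)) (D : set 'rV[R]_m) ub c
    (ka M : R) : 0 <= ka -> 0 <= M -> closed D -> D ub ->
  (forall z u, D u -> exists2 z', D (ub + z' *m A) &
     enorm (z - z') <= ka * enorm (ub + z *m A - u)) ->
  (forall z, D (ub + z *m A) -> 0 <= dotp c z + M * enorm z ^+ 2) ->
  exists l, [/\ c + l *m A^T = 0, enorm l <= 4 * ka * enorm c + 2 &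
    forall e : R, 0 < e -> exists u l', [/\ pnormal D u l', enorm (u - ub) < e &
      enorm (l' - l) < e]].
Proof.
move=> ka0 M0 cD Dub eb opt.
have [a a0 ha] := mulmx_bounded A^T.
have [|e [u l] /= e1 [_ _ _ lB]|l small] := @bounded_cluster_scale R _ m
    (fun e p => [/\ pnormal D p.1 p.2, enorm (p.1 - ub) < e,
      enorm (c + p.2 *m A^T) < e & enorm p.2 < 4 * ka * enorm c + e])
    snd (4 * ka * enorm c + 1).
- move=> e e0.
  by have [u [l ?]] := approximate_multiplier ka0 M0 cD Dub eb opt e0; exists (u, l).
- by lra.
exists l; split.
- apply: enorm0_eq0; apply/eqP; rewrite eq_le enorm_ge0 andbT.
  apply/ler_addgt0Pr => e e0; rewrite add0r.
  have [t t0 eE] : exists2 t, 0 < t & e = t * (a + 1).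
    have a1 : 0 < a + 1 by lra.
    by exists (e / (a + 1)); rewrite ?divr_gt0// divfK// gt_eqF.
  have [e' [[u l'] /= [e't [_ _ ck _] ll']]] := small _ t0.
  rewrite (_ : c + l *m A^T = (c + l' *m A^T) - (l' - l) *m A^T); last first.
    by rewrite mulmxBl opprB addrACA addrA addrK.
  apply: le_trans (enormB _ _) _.
  have h1 : enorm ((l' - l) *m A^T) <= a * t.
    by apply: le_trans (ha _) _; rewrite ler_wpM2l// ltW.
  rewrite eE; lra.
(* At scale 1 the slack of the bound on l' and the distance from l' to l are each below 1, hence the
   constant 2. *)
- have [e' [[u l'] /= [e't [_ _ _ l'B] ll']]] := small _ ltr01.
  have := enorm_triangle l' l 0; rewrite !subr0 (enormC l); lra.
- move=> e e0; have [e' [[u l'] /= [e't [? uu _ _] ll']]] := small _ e0.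
  by exists u, l'; split=> //; exact: lt_trans uu e't.
Qed.
End Multiplier.

(** * Second-order tangent sets and their normals *)

Section SecondOrderTangents.
Variable R : realType.
Implicit Types n m : nat.

(* Both second-order tangent sets are instances: the ratio t / r tends to 0 for
   [tcone2a] and to 1 for [tcone2]. *)
Definition tconer n (th : R) (S : set 'rV[R]_n) (y v : 'rV[R]_n) : set 'rV[R]_n :=
  [set w | exists (t r : nat -> R) (wk : nat -> 'rV[R]_n),
     [/\ down0 t, down0 r, (fun k => t k / r k) @ \oo --> th,
         wk @ \oo --> w &
         forall k, S (y + t k *: v + (2^-1 * t k * r k) *: wk k)]].

Lemma tcone2aE n (S : set 'rV[R]_n) y v : tcone2a S y v = tconer 0 S y v.
Proof. by []. Qed.

Lemma tcone2E n (S : set 'rV[R]_n) y v : tcone2 S y v = tconer 1 S y v.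
Proof.
apply/seteqP; split=> w.
  move=> [t [wk [[t0 tt] ww h]]]; exists t, t, wk; split=> //.
    by refine (cvg_ext _ _ (cvg_cst (1 : R))) => // k; rewrite divff// gt_eqF.
  by move=> k; rewrite -mulrA -expr2.
move=> [t [r [wk [[t0 tt] [r0 rr] tr ww h]]]].
(* Since r / t tends to 1, r can be traded for t by rescaling the vectors without changing their
   limit. *)
exists t, (fun k => (r k / t k) *: wk k); split=> //.
  rewrite -(scale1r w); apply: cvgZ => //.
  refine (cvg_ext _ _ (cvgV _ tr)) => [k||].
  - by rewrite -[RHS]/((t k / r k)^-1) invf_div.
  - by rewrite invr1.
  - exact: oner_neq0.
move=> k; rewrite scalerA (_ : _ * (r k / t k) = 2^-1 * t k * r k)//.
by field; rewrite gt_eqF.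
Qed.

Lemma natSinv_cvg (x : nat -> R) l :
  (forall k, `|x k - l| < k.+1%:R^-1) -> x @ \oo --> l.
Proof.
move=> h; apply/cvgrPdist_lt => e e0; near=> k; rewrite distrC.
apply: lt_trans (h k) _; near: k; exact: (near_infty_natSinv_lt (PosNum e0)).
Unshelve. all: by end_near. Qed.

Lemma natSinv_cvg_row n (x : nat -> 'rV[R]_n) l :
  (forall k, enorm (x k - l) < k.+1%:R^-1) -> x @ \oo --> l.
Proof.
move=> h; apply: enorm_lt_cvg => e e0; near=> k.
apply: lt_trans (h k) _; near: k; exact: (near_infty_natSinv_lt (PosNum e0)).
Unshelve. all: by end_near. Qed.

Lemma natSinv_down0 (x : nat -> R) :
  (forall k, 0 < x k < k.+1%:R^-1) -> down0 x.
Proof.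
move=> h; split=> [k|]; first by case/andP: (h k).
by apply: natSinv_cvg => k; have /andP[? ?] := h k; rewrite subr0 gtr0_norm.
Qed.

(** Countable choice at the scales 1 / (k + 1) removes the sequences; closedness and diagonal
    arguments then become triangle inequalities. [dnormalP] does the same for directional
    normals. *)
Lemma tconerP n (th : R) (S : set 'rV[R]_n) y v w : tconer th S y v w <->
  forall e : R, 0 < e -> exists t r w', [/\ 0 < t < e, 0 < r < e,
    `|t / r - th| < e, enorm (w' - w) < e &
    S (y + t *: v + (2^-1 * t * r) *: w')].
Proof.
split=> [[t [r [wk [[t0 tt] [r0 rr] tr ww h]]]] e e0|h].
  near \oo => k; exists (t k), (r k), (wk k); split=> //.
  - by rewrite t0; near: k; exact: (cvgr_lt _ tt).
  - by rewrite r0; near: k; exact: (cvgr_lt _ rr).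
  - by rewrite distrC; near: k; exact: (cvgr_dist_lt _ _ tr).
  - by near: k; exact: cvg_enorm_lt.
have : forall k : nat, exists p : R * R * 'rV[R]_n, [/\ 0 < p.1.1 < k.+1%:R^-1,
    0 < p.1.2 < k.+1%:R^-1, `|p.1.1 / p.1.2 - th| < k.+1%:R^-1,
    enorm (p.2 - w) < k.+1%:R^-1 &
    S (y + p.1.1 *: v + (2^-1 * p.1.1 * p.1.2) *: p.2)].
  move=> k; have [|t [r [w' ?]]] := h k.+1%:R^-1; first by rewrite invr_gt0.
  by exists (t, r, w').
move=> /choice[p hp].
exists (fun k => (p k).1.1), (fun k => (p k).1.2), (fun k => (p k).2).
split.
- by apply: natSinv_down0 => k; have [] := hp k.
- by apply: natSinv_down0 => k; have [] := hp k.
- by apply: natSinv_cvg => k; have [] := hp k.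
- by apply: natSinv_cvg_row => k; have [] := hp k.
- by move=> k; have [] := hp k.
Unshelve. all: by end_near. Qed.

Lemma tconer_closed n (th : R) (S : set 'rV[R]_n) y v : closed (tconer th S y v).
Proof.
apply: adherent_closed => w h; apply/tconerP => e e0.
have e2 : 0 < e / 2 by lra.
have [w1 /tconerP/(_ _ e2)[t [r [w' [/andP[t0 te] /andP[r0 re] tr w'1 Sw']]]] w1w] := h _ e2.
exists t, r, w'; split=> //.
- by rewrite t0/=; lra.
- by rewrite r0/=; lra.
- lra.
- have := enorm_triangle w1 w' w; lra.
Qed.

Lemma dnormalP n (K : set 'rV[R]_n) y v l : dnormal K y v l <->
  forall e : R, 0 < e -> exists t u l', [/\ 0 < t < e, enorm (u - v) < e,
    enorm (l' - l) < e & rnormal K (y + t *: u) l'].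
Proof.
split=> [[t [uk [lk [[t0 tt] uu ll h]]]] e e0|h].
  near \oo => k; exists (t k), (uk k), (lk k); split=> //.
  - by rewrite t0; near: k; exact: (cvgr_lt _ tt).
  - by near: k; exact: cvg_enorm_lt.
  - by near: k; exact: cvg_enorm_lt.
have : forall k : nat, exists p : R * 'rV[R]_n * 'rV[R]_n,
    [/\ 0 < p.1.1 < k.+1%:R^-1, enorm (p.1.2 - v) < k.+1%:R^-1,
    enorm (p.2 - l) < k.+1%:R^-1 & rnormal K (y + p.1.1 *: p.1.2) p.2].
  move=> k; have [|t [r [w' ?]]] := h k.+1%:R^-1; first by rewrite invr_gt0.
  by exists (t, r, w').
move=> /choice[p hp].
exists (fun k => (p k).1.1), (fun k => (p k).1.2), (fun k => (p k).2).
split.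
- by apply: natSinv_down0 => k; have [] := hp k.
- by apply: natSinv_cvg_row => k; have [] := hp k.
- by apply: natSinv_cvg_row => k; have [] := hp k.
- by move=> k; have [] := hp k.
Unshelve. all: by end_near. Qed.

Lemma dnormal_adherent n (K : set 'rV[R]_n) y v l :
  (forall e : R, 0 < e -> exists2 l', dnormal K y v l' & enorm (l' - l) < e) ->
  dnormal K y v l.
Proof.
move=> h; apply/dnormalP => e e0; have e2 : 0 < e / 2 by lra.
have [l1 /dnormalP/(_ _ e2)[t [u [l' [/andP[t0 te] uv l'1 Kl']]]] l1l] := h _ e2.
exists t, u, l'; split=> //.
- by rewrite t0/=; lra.
- lra.
- have := enorm_triangle l1 l' l; lra.
Qed.

Lemma lnormal_adherent n (S : set 'rV[R]_n) y l :
  (forall e : R, 0 < e -> exists u l', [/\ pnormal S u l', enorm (u - y) < e &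
     enorm (l' - l) < e]) -> lnormal S y l.
Proof.
move=> h.
have : forall k : nat, exists p : 'rV[R]_n * 'rV[R]_n, [/\ pnormal S p.1 p.2,
    enorm (p.1 - y) < k.+1%:R^-1 & enorm (p.2 - l) < k.+1%:R^-1].
  move=> k; have [|t [r ?]] := h k.+1%:R^-1; first by rewrite invr_gt0.
  by exists (t, r).
move=> /choice[p hp]; exists (fun k => (p k).1), (fun k => (p k).2); split.
- by move=> k; have [[]] := hp k.
- by apply: natSinv_cvg_row => k; have [] := hp k.
- by apply: natSinv_cvg_row => k; have [] := hp k.
- by move=> k; apply: pnormal_rnormal; have [] := hp k.
Qed.

Lemma projection_exists n (S : set 'rV[R]_n) p : closed S -> S !=set0 ->
  exists2 x, S x & forall y, S y -> enorm (x - p) <= enorm (y - p).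
Proof.
move=> cS [x0 Sx0]; apply: (@coercive_min _ _ S (fun x => enorm (x - p)) x0
    (enorm (x0 - p) + enorm (x0 - p))) => // [x|x _ le].
  have h T F (FF : Filter F) (u : T -> 'rV[R]_n) (a : 'rV[R]_n) : u @ F --> a ->
      (fun z => enorm (u z - p)) @ F --> enorm (a - p).
    by move=> ua; apply: enorm_continuous; apply: cvgB => //; exact: cvg_cst.
  exact: (h _ (nbhs x) _ id).
have := enorm_triangle p x x0; rewrite (enormC p); lra.
Qed.

(* The point u + s l has u as its only projection on the tangent set, so its
   projections on the blow-ups of K converge to u, and each of them carries a
   proximal normal of K. *)
Lemma pnormal_tconer_dnormal n (th : R) (K : set 'rV[R]_n) y v u : closed K ->
  pnormal (tconer th K y v) u `<=` dnormal K y v.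
Proof.
move=> cK l [Tu [M M0 hM]].
(* Any s with s M < 1/2 makes u the unique projection of u + s l. *)
have [s s0 sM] : exists2 s : R, 0 < s & s * M = 4^-1.
  exists (4 * M)^-1; first by rewrite invr_gt0 mulr_gt0.
  by field; rewrite gt_eqF.
pose p := u + s *: l.
pose D t r := [set x : 'rV[R]_n | K (y + t *: v + (2^-1 * t * r) *: x)].
have cD t r : closed (D t r).
  apply: (@closed_comp _ _ (fun x : 'rV[R]_n => y + t *: v + (2^-1 * t * r) *: x) K) => //.
  have h T F (FF : Filter F) (w : T -> 'rV[R]_n) (a : 'rV[R]_n) : w @ F --> a ->
      (fun x => y + t *: v + (2^-1 * t * r) *: w x) @ F -->
      y + t *: v + (2^-1 * t * r) *: a.
    by move=> wa; apply: cvgD; [exact: cvg_cst|apply: cvgZ => //; exact: cvg_cst].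
  by move=> x _; exact: (h _ (nbhs x) _ id).
have [|e [[t r] z] /= e1 [_ _ _ _ [h _]]|x small] :=
  @bounded_cluster_scale R _ n (fun e q => [/\ 0 < q.1.1 < e, 0 < q.1.2 < e,
        `|q.1.1 / q.1.2 - th| < e, D q.1.1 q.1.2 q.2 &
        enorm (q.2 - p) < enorm (u - p) + e /\
        forall x, D q.1.1 q.1.2 x -> enorm (q.2 - p) <= enorm (x - p)])
    snd (enorm (u - p) + 1 + enorm p).
- move=> e e0; have /tconerP/(_ _ e0)[t [r [u' [t0 r0 tr uu' Ku']]]] := Tu.
  have [|x Dx xmin] := projection_exists p (cD t r); first by exists u'.
  exists (t, r, x); split=> //=; split=> //.
  have := xmin _ Ku'; have := enorm_triangle u u' p; lra.
- by have := enormD (z - p) p; rewrite subrK; lra.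
have Tx : tconer th K y v x.
  apply/tconerP => e e0.
  have [e' [[[t r] z] /= [ee' [/andP[t0 t1] /andP[r0 r1] tr Kz _] zx]]] := small e e0.
  exists t, r, z; split=> //.
  - by rewrite t0 (lt_trans t1).
  - by rewrite r0 (lt_trans r1).
  - exact: lt_trans tr ee'.
have xp : enorm (x - p) <= enorm (u - p).
  apply/ler_addgt0Pr => e e0; have e2 : 0 < e / 2 by lra.
  have [e' [[[t r] z] /= [ee' [_ _ _ _ [h _]] zx]]] := small _ e2.
  by have := enorm_triangle z x p; rewrite (enormC x z); lra.
(* With w = x - u, |x - p| <= |u - p| gives |w|^2 <= 2 s <l, w> <= 2 s M |w|^2 = |w|^2 / 2. *)
have xu : x = u.
  apply/eqP; rewrite -subr_eq0; apply/eqP/enorm0_eq0/eqP.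
  rewrite -sqrf_eq0 eq_le sqr_ge0 andbT.
  have : enorm (x - p) ^+ 2 <= enorm (u - p) ^+ 2.
    by rewrite ler_pXn2r ?nnegrE ?enorm_ge0.
  have -> : x - p = (x - u) - s *: l by rewrite /p opprD addrA.
  have -> : u - p = - (s *: l) by rewrite /p opprD addrA subrr add0r.
  have := hM _ Tx; rewrite -(ler_pM2l s0) mulrA sM; move: (x - u) => w.
  rewrite !sqr_enorm !(dotpBl, dotpBr, dotpNl, dotpNr, dotpZl, dotpZr) (dotpC w l).
  lra.
apply/dnormalP => e e0.
(* In turn these bounds control t, the error on the normal, the norm of z, and the error on the
   direction. *)
have [e' [e'0 e'e e's e'1 e'u]] : exists e', [/\ 0 < e', e' <= e, e' <= s * e,
    e' <= 1 & e' * (enorm u + 1) <= e].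
  have u1 : 0 < enorm u + 1 by have := enorm_ge0 u; lra.
  exists (Num.min (Num.min e (s * e)) (Num.min 1 (e / (enorm u + 1)))).
  by rewrite -ler_pdivlMr// !lt_min !ge_min !lexx !orbT e0 ltr01 mulr_gt0// divr_gt0.
have [e2 [[[t r] z] /= [e2e' [/andP[t0 t1] /andP[r0 r1] _ Dq [_ qmin]] zu]]] :=
  small _ e'0.
rewrite xu in zu.
have te : t < e' := lt_trans t1 e2e'.
have re : r < e' := lt_trans r1 e2e'.
(* The projection residual p - z is close to p - u = s l, hence the factor 1 / s. *)
exists t, (v + (2^-1 * r) *: z), (s^-1 *: (p - z)); split.
- by rewrite t0 (lt_le_trans te).
- rewrite addrAC subrr add0r enormZ gtr0_norm ?mulr_gt0//.
  have zn : enorm z <= enorm u + 1.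
    by have := enormD (z - u) u; rewrite subrK; lra.
  have : r * enorm z <= e' * (enorm u + 1).
    by rewrite ler_pM ?enorm_ge0// ltW.
  lra.
- have -> : s^-1 *: (p - z) - l = s^-1 *: (u - z).
    by rewrite /p addrAC scalerDr scalerA mulVf ?gt_eqF// scale1r addrK.
  rewrite enormZ gtr0_norm ?invr_gt0// ltr_pdivrMl// enormC.
  exact: lt_le_trans zu e's.
- apply: pnormal_rnormal.
  pose c := 2^-1 * t * r; have c0 : 0 < c by rewrite !mulr_gt0.
  have -> : y + t *: (v + (2^-1 * r) *: z) = y + t *: v + c *: z.
    by rewrite scalerDr addrA scalerA mulrCA mulrA.
  (* A projection residual is proximal with constant 1/2; the factor 1 / s and the dilation by c
     turn this into 1 / (2 s c). *)
  split=> //; exists (s^-1 / (2 * c)); first by rewrite divr_gt0 ?invr_gt0 ?mulr_gt0.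
  move=> y' Ky'; pose x' := c^-1 *: (y' - (y + t *: v)).
  have y'E : y' = y + t *: v + c *: x'.
    by rewrite /x' scalerA mulfV ?gt_eqF// scale1r addrC subrK.
  have Dx' : D t r x' by rewrite /D /= -/c -y'E.
  have -> : y' - (y + t *: v + c *: z) = c *: (x' - z).
    by rewrite y'E opprD addrACA subrr add0r scalerBr.
  have : enorm (z - p) ^+ 2 <= enorm (x' - p) ^+ 2.
    by rewrite ler_pXn2r ?nnegrE ?enorm_ge0// qmin.
  have -> : x' - p = (x' - z) - (p - z) by rewrite opprB addrA subrK.
  rewrite -(enormN (z - p)) opprB; move: (p - z) (x' - z) => a b.
  rewrite enormZ (gtr0_norm c0) !sqr_enorm !(dotpBl, dotpBr, dotpZl, dotpZr) (dotpC b a).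
  rewrite exprMn sqr_enorm => le.
  have -> : s^-1 / (2 * c) * (c ^+ 2 * dotp b b) = s^-1 * (c * (dotp b b / 2)).
    by field; rewrite !gt_eqF.
  rewrite ler_pM2l ?invr_gt0// ler_pM2l//; lra.
Qed.
End SecondOrderTangents.

(** * From directional subregularity to error bounds on tangent sets *)

Section DirectionalSubregularity.
Variable R : realType.
Implicit Types n m : nat.

(** With [perturbed_pointE], a second-order curve is read as a first-order one along directions
    tending to d, as [taylor2_seq] and [Vdir_near] require. *)
Lemma perturbed_direction_cvg n (r : nat -> R) (wk : nat -> 'rV[R]_n)
    (d w : 'rV[R]_n) :
  down0 r -> wk @ \oo --> w ->
  (fun k => d + (2^-1 * r k) *: wk k) @ \oo --> d.
Proof.
move=> [_ rr] ww.
have h : (fun k => d + (2^-1 * r k) *: wk k) @ \oo --> d + (2^-1 * 0) *: w.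
  apply: cvgD; first exact: cvg_cst.
  by apply: cvgZ => //; apply: cvgM => //; exact: cvg_cst.
by refine (cvg_ext _ _ h) => //; rewrite mulr0 scale0r addr0.
Qed.

Lemma perturbed_pointE n (x d w : 'rV[R]_n) (t r : R) :
  x + t *: d + (2^-1 * t * r) *: w = x + t *: (d + (2^-1 * r) *: w).
Proof. by rewrite scalerDr addrA scalerA mulrCA mulrA. Qed.

Lemma Vdir_near n (rho delta : R) (d : 'rV[R]_n) (t : nat -> R)
    (dk : nat -> 'rV[R]_n) : 0 < rho -> 0 < delta -> down0 t -> dk @ \oo --> d ->
  \forall k \near \oo, Vdir rho delta d (t k *: dk k).
Proof.
move=> rho0 delta0 [t0 tt] dd.
have hn : (fun k => enorm (dk k)) @ \oo --> enorm d by exact: enorm_continuous.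
have ht : (fun k => enorm (t k *: dk k)) @ \oo --> (0 : R).
  rewrite -(enorm0 R n) -(scale0r d); apply: enorm_continuous.
  exact: cvgZ.
have h1 : \forall k \near \oo, enorm (t k *: dk k) <= delta.
  exact: (cvgr_le _ ht).
(* For d = 0 both sides of the angular condition vanish; otherwise it is homogeneous in t and holds
   once |dk| > |d| / 2 and the angular defect is small. *)
have [d0|d0] := eqVneq (enorm d) 0.
  near=> k; split; first by near: k.
  rewrite d0 scale0r (enorm0_eq0 d0) scaler0 subrr enorm0 mulr0.
  exact: lexx.
have dp : 0 < enorm d by rewrite lt_def d0 enorm_ge0.
have hX : (fun k => enorm (enorm d *: dk k - enorm (dk k) *: d)) @ \oo --> (0 : R).
  rewrite -(enorm0 R n) -(subrr (enorm d *: d)); apply: enorm_continuous.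
  by apply: cvgB; apply: cvgZ => //; exact: cvg_cst.
pose c := rho * (enorm d / 2) * enorm d.
have c0 : 0 < c by rewrite !mulr_gt0.
near=> k; split; first by near: k.
have hk : enorm (enorm d *: dk k - enorm (dk k) *: d) < c.
  by near: k; exact: (cvgr_lt _ hX).
have nk : enorm d / 2 < enorm (dk k).
  near: k; apply: (cvgr_gt _ hn).
  by rewrite gtr_pMr// invf_lt1// ltr1n.
have tk := t0 k.
rewrite enormZ gtr0_norm// scalerA mulrC -scalerA -scalerA -scalerBr.
rewrite enormZ gtr0_norm// [rho * _]mulrCA -mulrA ler_pM2l//.
apply: le_trans (ltW hk) _.
by rewrite /c ler_pM2r// ler_pM2l// ltW.
Unshelve. all: by end_near. Qed.

(** The first-order error dk - d is absorbed into the second-order term: r is fixed first, then t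
    and |dk - d| are taken small compared with r. This supplies the base point of part (a). *)
Lemma tcone_tconer0 n (S : set 'rV[R]_n) x d : tcone S x d -> tconer 0 S x d 0.
Proof.
move=> [t [dk [[t0 tt] dd h]]]; apply/tconerP => e e0.
pose r := e / 2; have r0 : 0 < r by rewrite /r; lra.
have re : r < e by rewrite /r; lra.
have er : 0 < e * r by rewrite mulr_gt0.
near \oo => k.
have tk := t0 k.
have te : t k < e by near: k; exact: (cvgr_lt _ tt).
have te2 : t k < e * r by near: k; exact: (cvgr_lt _ tt).
have dk2 : enorm (dk k - d) < e * r / 2.
  by near: k; apply: cvg_enorm_lt => //; lra.
exists (t k), r, ((2 / r) *: (dk k - d)); split.
- by rewrite tk te.
- by rewrite r0 re.
- by rewrite subr0 gtr0_norm ?divr_gt0// ltr_pdivrMr.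
- rewrite subr0 enormZ gtr0_norm ?divr_gt0//.
  by rewrite mulrAC ltr_pdivrMr//; lra.
- rewrite scalerA (_ : 2^-1 * t k * r * (2 / r) = t k); last first.
    by field; rewrite gt_eqF.
  by rewrite scalerBr -addrA subrKC; exact: h.
Unshelve. all: by end_near. Qed.

(** The increment of f along the curve is nonnegative; divided by t r / 2, with the term in <G, d>
    vanishing, it tends to the claimed quantity, since the Hessian term carries the weight t / r. *)
Lemma tconer_ge0 n (f : 'rV[R]_n -> R) G H (S : set 'rV[R]_n) xb d
    (rho delta th : R) w : C2 f G H -> 0 < rho -> 0 < delta ->
  (forall x, S x -> Vdir rho delta d (x - xb) -> f xb <= f x) ->
  dotp (G xb) d = 0 -> tconer th S xb d w ->
  0 <= dotp (G xb) w + th * quadf (H xb) d.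
Proof.
move=> hC rho0 delta0 opt Gd [t [r [wk [dt dr tr ww h]]]].
have dd := perturbed_direction_cvg (d := d) dr ww.
have [t0 _] := dt; have [r0 _] := dr.
have hT := taylor2_seq (x := xb) hC dt dd.
have hL : (fun k => dotp (G xb) (wk k) + 2 * (t k / r k) * ((t k ^+ 2)^-1 *
     (f (xb + t k *: (d + (2^-1 * r k) *: wk k)) - f xb
      - t k * dotp (G xb) (d + (2^-1 * r k) *: wk k)))) @ \oo -->
    dotp (G xb) w + 2 * th * (2^-1 * quadf (H xb) d).
  apply: cvgD; first by apply: dotp_continuous => //; exact: cvg_cst.
  by apply: cvgM => //; apply: cvgM => //; exact: cvg_cst.
have -> : th * quadf (H xb) d = 2 * th * (2^-1 * quadf (H xb) d) by field.
have hV := Vdir_near rho0 delta0 dt dd.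
apply: (cvgr_to_ge hL); near=> k.
have [tk rk] := (t0 k, r0 k).
have := opt _ (h k); rewrite perturbed_pointE addrAC subrr add0r.
have Vk : Vdir rho delta d (t k *: (d + (2^-1 * r k) *: wk k)) by near: k.
move=> /(_ Vk); set F := f (_ + _) => fF.
rewrite dotpDr Gd add0r dotpZr.
rewrite (_ : _ + _ = 2 / (t k * r k) * (F - f xb)).
  by rewrite mulr_ge0 ?subr_ge0// divr_ge0// mulr_ge0// ltW.
by field; rewrite !gt_eqF.
Unshelve. all: by end_near. Qed.

Section Feasible.
Variables (n m : nat) (g : 'rV[R]_n -> 'rV[R]_m) (K : set 'rV[R]_m).
Variables (xb d : 'rV[R]_n) (A : 'M[R]_(n, m)) (q : 'rV[R]_m).
Hypothesis taylor_g : forall (t : nat -> R) (dk : nat -> 'rV[R]_n),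
  down0 t -> dk @ \oo --> d ->
  (fun k => (t k ^+ 2)^-1 *: (g (xb + t k *: dk k) - g xb - t k *: (dk k *m A)))
    @ \oo --> 2^-1 *: q.

Let C := g @^-1` K.

Lemma tconer_image (th : R) w :
  tconer th C xb d w -> tconer th K (g xb) (d *m A) (w *m A + th *: q).
Proof.
move=> [t [r [wk [dt dr tr ww h]]]].
have dd := perturbed_direction_cvg (d := d) dr ww.
have [t0 _] := dt; have [r0 _] := dr.
have hT := taylor_g dt dd.
(* This is the exact second-order quotient of g along the curve, so the image curve passes through
   the points g(x_k) of K. *)
exists t, r, (fun k => wk k *m A + (2 * (t k / r k)) *: ((t k ^+ 2)^-1 *:
     (g (xb + t k *: (d + (2^-1 * r k) *: wk k)) - g xb
      - t k *: ((d + (2^-1 * r k) *: wk k) *m A)))); split=> //.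
  have -> : th *: q = (2 * th) *: (2^-1 *: q).
    by rewrite scalerA; congr (_ *: _); field.
  apply: cvgD; first exact: mulmx_continuous.
  by apply: cvgZ => //; apply: cvgM => //; exact: cvg_cst.
move=> k; have [tk rk] := (t0 k, r0 k).
have := h k; rewrite /C /= perturbed_pointE; set y := g (_ + _) => Ky.
rewrite [X in K X](_ : _ = y)//.
rewrite scalerDr !scalerA [X in X *: (y - _ - _)](_ : _ = 1); last first.
  by field; rewrite !gt_eqF.
rewrite scale1r mulmxDl scalerDr -scalemxAl scalerA.
rewrite (_ : t k * (2^-1 * r k) = 2^-1 * t k * r k); last by ring.
rewrite addrA -(addrA (g xb)) -[y - _ - _]addrA -opprD addrC subrK.
by [].
Qed.

Variables (rho delta ka : R).
Hypotheses (rho0 : 0 < rho) (delta0 : 0 < delta) (ka0 : 0 < ka).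
Hypothesis mscq : forall x, Vdir rho delta d (x - xb) ->
  (setdist x C <= ka%:E * setdist (g x) K)%E.

(** Run the curve with w fixed at the scales (t, r) realizing u. The gap between its image and K is
    at most (t r / 2) |s_k|, with s_k tending to the residual; MSCQ moves the curve into C at
    proportional cost, and the rescaled displacements cluster. *)
Lemma tconer_error_bound (th : R) w u : tconer th K (g xb) (d *m A) u ->
  exists2 w', tconer th C xb d w' &
    enorm (w - w') <= ka * enorm (w *m A + th *: q - u).
Proof.
move=> [t [r [uk [dt dr tr uu h]]]].
have ww : (fun=> w) @ \oo --> w by exact: cvg_cst.
have dd := perturbed_direction_cvg (d := d) dr ww.
have [t0 tt] := dt; have [r0 rr] := dr.
have hT := taylor_g dt dd.
pose s k := w *m A + (2 * (t k / r k)) *: ((t k ^+ 2)^-1 *: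
     (g (xb + t k *: (d + (2^-1 * r k) *: w)) - g xb
      - t k *: ((d + (2^-1 * r k) *: w) *m A))) - uk k.
have hs : (fun k => enorm (s k)) @ \oo --> enorm (w *m A + th *: q - u).
  apply: enorm_continuous.
  have -> : th *: q = (2 * th) *: (2^-1 *: q).
    by rewrite scalerA; congr (_ *: _); field.
  apply: cvgB => //; apply: cvgD; first exact: cvg_cst.
  by apply: cvgZ => //; apply: cvgM => //; exact: cvg_cst.
set b := enorm (_ - u) in hs *.
have hV := Vdir_near rho0 delta0 dt dd.
have [|e [[t' r'] w'] /= e1 [_ _ _ _ h1]|w' small] :=
  @bounded_cluster_scale R _ n (fun e p =>
    [/\ 0 < p.1.1 < e, 0 < p.1.2 < e, `|p.1.1 / p.1.2 - th| < e,
        C (xb + p.1.1 *: d + (2^-1 * p.1.1 * p.1.2) *: p.2) &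
        enorm (w - p.2) < ka * b + e]) snd (enorm w + ka * b + 1).
- move=> e e0; near \oo => k.
  have [tk rk] := (t0 k, r0 k).
  have Vk : Vdir rho delta d (t k *: (d + (2^-1 * r k) *: w)) by near: k.
  have sk : enorm (s k) < b + e / ka.
    by near: k; apply: (cvgr_lt _ hs); rewrite ltrDl divr_gt0.
  have te : t k < e by near: k; exact: (cvgr_lt _ tt).
  have re : r k < e by near: k; exact: (cvgr_lt _ rr).
  have tre : `|t k / r k - th| < e.
    by rewrite distrC; near: k; exact: (cvgr_dist_lt _ _ tr).
  pose c := 2^-1 * t k * r k; have c0 : 0 < c by rewrite !mulr_gt0.
  set x := xb + t k *: (d + (2^-1 * r k) *: w).
  have Vx : Vdir rho delta d (x - xb) by rewrite /x addrAC subrr add0r.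
  have dK : (setdist (g x) K <= (c * enorm (s k))%:E)%E.
    apply: ereal_inf_lbound; exists (g xb + t k *: (d *m A) + c *: uk k); first exact: h.
    congr (_%:E); rewrite -{2}(gtr0_norm c0) -enormZ; congr enorm.
    rewrite /s -/x scalerBr scalerDr !scalerA [X in X *: (g x - _ - _)](_ : _ = 1); last first.
      by rewrite /c; field; rewrite !gt_eqF.
    rewrite scale1r mulmxDl scalerDr -scalemxAl scalerA.
    rewrite (_ : t k * (2^-1 * r k) = c); last by rewrite /c; ring.
    rewrite !opprD !addrA; congr (_ - _).
    by rewrite -!(addrA (c *: _)) [RHS]addrC subrK.
  have dC : (setdist x C < (c * (ka * b + e))%:E)%E.
    apply: le_lt_trans (mscq Vx) _.
    apply: (@le_lt_trans _ _ (ka%:E * (c * enorm (s k))%:E)%E).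
      by apply: lee_wpmul2l => //; rewrite lee_fin ltW.
    rewrite -EFinM lte_fin mulrCA ltr_pM2l//.
    have -> : ka * b + e = ka * (b + e / ka) by field; rewrite gt_eqF.
    by rewrite ltr_pM2l.
  have [_ [x' Cx' <-]] := ereal_inf_lt dC; rewrite lte_fin => xx'.
  (* The second-order coordinate of the nearby point x' of C on the same curve scale. *)
  exists (t k, r k, w + c^-1 *: (x' - x)); split=> /=.
  - by rewrite tk te.
  - by rewrite rk re.
  - by [].
  - rewrite -/c scalerDr scalerA mulfV ?gt_eqF// scale1r addrA.
    by rewrite perturbed_pointE -/x addrC subrK.
  - rewrite opprD addrA subrr add0r enormN enormZ gtr0_norm ?invr_gt0//.
    by rewrite ltr_pdivrMl// enormC.
- by have := enormB w (w - w'); rewrite subKr; lra.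
exists w'.
  apply/tconerP => e e0.
  have [e' [[[t' r'] z] /= [ee' [/andP[? t1] /andP[? r1] tr1 Cp _] zw]]] := small e e0.
  exists t', r', z; split=> //.
  - by apply/andP; split=> //; exact: lt_trans t1 ee'.
  - by apply/andP; split=> //; exact: lt_trans r1 ee'.
  - exact: lt_trans tr1 ee'.
apply/ler_addgt0Pr => e e0; have e2 : 0 < e / 2 by lra.
have [e' [[[t' r'] z] /= [ee' [_ _ _ _ wz] zw]]] := small _ e2.
by have := enorm_triangle z w w'; lra.
Unshelve. all: by end_near. Qed.

(** Recentred at [wb], the error bound and the minimality hypothesis are those of
    [exact_multiplier]; its proximal normals yield both kinds of limiting normal. *)
Lemma tangent_multiplier (th M : R) wb c : closed K -> 0 <= M ->
  tconer th C xb d wb ->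
  (forall w, tconer th C xb d w ->
     0 <= dotp c (w - wb) + M * enorm (w - wb) ^+ 2) ->
  exists l, [/\ c + l *m A^T = 0, enorm l <= 4 * ka * enorm c + 2,
    dnormal K (g xb) (d *m A) l &
    lnormal (tconer th K (g xb) (d *m A)) (wb *m A + th *: q) l].
Proof.
move=> cK M0 Twb opt.
have ubE z : wb *m A + th *: q + z *m A = (wb + z) *m A + th *: q.
  by rewrite mulmxDl addrAC.
have := @exact_multiplier R n m A (tconer th K (g xb) (d *m A))
  (wb *m A + th *: q) c ka M (ltW ka0) M0 (@tconer_closed _ _ _ _ _ _)
  (tconer_image Twb).
case.
- move=> z u Tu; have [w' Tw' le] := tconer_error_bound (wb + z) Tu.
  exists (w' - wb); first by rewrite ubE subrKC; exact: tconer_image.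
  by rewrite ubE opprB addrA (addrC z).
- move=> z; rewrite ubE => Tz.
  (* At zero residual the error bound is an equality of points: the linearized constraint
     characterizes the tangent set of C. *)
  have [w' Tw'] := tconer_error_bound (wb + z) Tz.
  rewrite subrr enorm0 mulr0 => le0.
  have /enorm0_eq0/eqP : enorm (wb + z - w') = 0.
    by apply/eqP; rewrite eq_le le0 enorm_ge0.
  rewrite subr_eq0 => /eqP E; move: Tw'; rewrite -E => /opt.
  by rewrite addrAC subrr add0r.
- move=> l [El nl hl]; exists l; split=> //.
    apply: dnormal_adherent => e e0; have [u [l' [pl' _ ?]]] := hl e e0.
    by exists l' => //; exact: pnormal_tconer_dnormal pl'.
  exact: lnormal_adherent.
Qed.
End Feasible.
End DirectionalSubregularity.

(** * Tikhonov regularization of a linear objective *)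

Section Regularization.
Variable R : realType.

(* Tikhonov regularization: an infimum that is not attained is approached by the
   minimizers of [<c, w> + eps / 2 |w|^2], whose residual [eps w] satisfies
   [<eps w, w> -> 0] even when they are unbounded. *)
Lemma regularized_minimizer n (T : set 'rV[R]_n) c (a e : R) w1 :
  closed T -> (forall w, T w -> a <= dotp c w) -> 0 < e ->
  T w1 -> dotp c w1 < a + e / 4 ->
  exists (eps : R) w, [/\ 0 < eps, T w, dotp c w < a + e,
    eps * enorm w ^+ 2 < e /\ enorm (eps *: w) < e &
    forall w', T w' ->
      0 <= dotp (c + eps *: w) (w' - w) + eps / 2 * enorm (w' - w) ^+ 2].
Proof.
move=> cT ha e0 Tw1 hw1.
have n1 : 0 <= enorm w1 ^+ 2 by rewrite sqr_ge0.
have [eps [eps0 epse epsw1]] : exists eps : R, [/\ 0 < eps, eps <= e &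
    eps * enorm w1 ^+ 2 < e / 2].
  have d0 : 0 < 4 * (enorm w1 ^+ 2 + 1) by lra.
  (* The second entry makes the regularized value at w1 less than a + e / 2, whence eps |w|^2 < e;
     the first then gives |eps w|^2 < e^2. *)
  exists (Num.min e (e / (4 * (enorm w1 ^+ 2 + 1)))); split.
  - by rewrite lt_min e0 divr_gt0.
  - by rewrite ge_min lexx.
  apply: (@le_lt_trans _ _ (e / (4 * (enorm w1 ^+ 2 + 1)) * enorm w1 ^+ 2)).
    by rewrite ler_wpM2r// ge_min lexx orbT.
  rewrite mulrAC ltr_pdivrMr// mulrAC -mulrA ltr_pM2l//; lra.
pose phi w := dotp c w + eps / 2 * dotp w w.
have cphi : continuous phi.
  have h U F (FF : Filter F) (u : U -> 'rV[R]_n) (l : 'rV[R]_n) : u @ F --> l ->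
      (fun x => dotp c (u x) + eps / 2 * dotp (u x) (u x)) @ F -->
      dotp c l + eps / 2 * dotp l l.
    move=> ul; apply: cvgD; first by apply: dotp_continuous => //; exact: cvg_cst.
    by apply: cvgM; [exact: cvg_cst|exact: dotp_continuous].
  by move=> x; exact: (h _ (nbhs x) _ id).
(* On the sublevel set |x|^2 <= b := (2 / eps) (phi w1 - a), hence |x| <= 1 + b. *)
pose B := 1 + 2 / eps * (phi w1 - a) + enorm w1.
have [|w Tw wmin] := @coercive_min R n T phi w1 B cT Tw1 cphi.
  move=> x Tx; rewrite {1}/phi -sqr_enorm => le.
  apply: le_trans (enormB _ _) _; rewrite lerD2r.
  have h1 : enorm x ^+ 2 <= 2 / eps * (phi w1 - a).
    rewrite -ler_pdivrMl ?divr_gt0// invf_div; have := ha _ Tx; lra.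
  move: h1; move: (2 / eps * _) => b.
  have := sqr_ge0 (enorm x - 1); have := sqr_ge0 (enorm x); lra.
have hw := wmin _ Tw1; rewrite /phi -!sqr_enorm in hw.
have hwa := ha _ Tw.
have ew0 : 0 <= eps * enorm w ^+ 2 by rewrite mulr_ge0 ?sqr_ge0// ltW.
have ew : eps * enorm w ^+ 2 < e by lra.
exists eps, w; split=> //.
- by lra.
- split=> //; rewrite -(ltr_pXn2r (n := 2)) ?nnegrE ?enorm_ge0 ?(ltW e0)//.
  rewrite enormZ gtr0_norm// exprMn expr2 -mulrA.
  apply: (@le_lt_trans _ _ (e * (eps * enorm w ^+ 2))); first by rewrite ler_wpM2r.
  by rewrite expr2 ltr_pM2l.
move=> w' Tw'; have := wmin _ Tw'; rewrite /phi -{1}(subrK w w').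
rewrite -{2 3}(subrK w w') sqr_enorm; move: (w' - w) => h.
rewrite !(dotpDl, dotpDr, dotpZl) (dotpC w h); lra.
Qed.
End Regularization.

(** * First- and second-order multipliers in the direction d *)

Unset Implicit Arguments.

Theorem theorem4p4 (R : realType) (n m : nat)
  (f : 'rV[R]_n -> R) (gradf : 'rV[R]_n -> 'rV[R]_n) (hessf : 'rV[R]_n -> 'M[R]_n)
  (g : 'rV[R]_n -> 'rV[R]_m)
  (gradg : 'I_m -> 'rV[R]_n -> 'rV[R]_n) (hessg : 'I_m -> 'rV[R]_n -> 'M[R]_n)
  (K : set 'rV[R]_m) (xb d : 'rV[R]_n) :
  C2 f gradf hessf ->
  (forall i : 'I_m, C2 (fun x => g x ord0 i) (gradg i) (hessg i)) ->
  closed K ->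
  let C := g @^-1` K in
  (* xb is feasible and locally optimal in direction d *)
  C xb ->
  (exists rho delta : R, [/\ 0 < rho, 0 < delta &
     forall x, C x -> Vdir rho delta d (x - xb) -> f xb <= f x]) ->
  tcone C xb d ->
  dotp (gradf xb) d = 0 ->
  (* MSCQ at xb in direction d *)
  (exists rho delta kappa : R, [/\ 0 < rho, 0 < delta, 0 < kappa &
     forall x, Vdir rho delta d (x - xb) ->
       (setdist x C <= kappa%:E * setdist (g x) K)%E]) ->
  (* derived objects *)
  let Dg := fun w : 'rV[R]_n => \row_(i < m) dotp (gradg i xb) w in
  let D2g := \row_(i < m) quadf (hessg i xb) d in
  let DgT := fun l : 'rV[R]_m => \sum_(i < m) l ord0 i *: gradg i xb in
  let Lam := [set l : 'rV[R]_m | dnormal K (g xb) (Dg d) l /\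
                 gradf xb + DgT l = 0] in
  let Theta := Dg @` tcone2a C xb d in
  let Omega := (fun w => Dg w + D2g) @` tcone2 C xb d in
  let hessL := fun l : 'rV[R]_m =>
                 quadf (hessf xb) d + \sum_(i < m) l ord0 i * quadf (hessg i xb) d in
  let alpha := ereal_inf [set (dotp (gradf xb) w + quadf (hessf xb) d)%:E
                          | w in tcone2 C xb d] in
  (exists2 l, Lam l &
     (supportf Theta l <= 0)%E /\ lnormal (tcone2a K (g xb) (Dg d)) 0 l) /\
  (tcone2 K (g xb) (Dg d) !=set0 ->
   exists2 l, Lam l &
     ((hessL l)%:E - supportf Omega l >= 0)%E /\
     exists (wk : nat -> 'rV[R]_n) (lk : nat -> 'rV[R]_m),
       [/\ forall k, tcone2 C xb d (wk k),
           forall k, lnormal (tcone2 K (g xb) (Dg d)) (Dg (wk k) + D2g) (lk k),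
           (fun k => (dotp (gradf xb) (wk k) + quadf (hessf xb) d)%:E) @ \oo --> alpha,
           (fun k => dotp (DgT (lk k) + gradf xb) (wk k)) @ \oo --> (0 : R) &
           lk @ \oo --> l]).
Proof.
move=> hf hg cK C Cxb [rho1 [delta1 [rho10 delta10 opt]]] Td fd.
move=> [rho [delta [ka [rho0 delta0 ka0 mscq]]]] Dg D2g DgT Lam Theta Omega hessL alpha.
(* The transposed Jacobian, since vectors are rows and act from the left. *)
pose A : 'M[R]_(n, m) := (\matrix_(i < m) gradg i xb)^T.
have DgE w : Dg w = w *m A.
  apply/rowP => i; rewrite !mxE dotpC; apply: eq_bigr => j _.
  by rewrite !mxE.
have DgTE l : DgT l = l *m A^T.
  by rewrite trmxK mulmx_sum_row; apply: eq_bigr => i _; rewrite rowK.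
have taylor_g (t : nat -> R) (dk : nat -> 'rV[R]_n) : down0 t -> dk @ \oo --> d ->
    (fun k => (t k ^+ 2)^-1 *: (g (xb + t k *: dk k) - g xb - t k *: (dk k *m A)))
    @ \oo --> 2^-1 *: D2g.
  move=> dt dd; apply: cvg_row => i.
  refine (cvg_ext _ _ (taylor2_seq (x := xb) (hg i) dt dd)) => [k|].
    by rewrite -DgE !mxE.
  by rewrite !mxE.
have ge0 th w : tconer th C xb d w ->
    0 <= dotp (gradf xb) w + th * quadf (hessf xb) d.
  exact: (tconer_ge0 hf rho10 delta10 opt fd).
have mult th M wb c := @tangent_multiplier R n m g K xb d A D2g taylor_g
  rho delta ka rho0 delta0 ka0 mscq th M wb c cK.
(* Through this identity the lower bounds [ge0] on the objective become upper bounds on the support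
   functions. *)
have dotDg l w : gradf xb + l *m A^T = 0 -> dotp l (w *m A) = - dotp (gradf xb) w.
  move=> /eqP; rewrite addrC addr_eq0 => /eqP El.
  by rewrite dotpC dotp_mulmxl El dotpNr dotpC.
split.
  have T0 := tcone_tconer0 Td.
  (* Part (a): w = 0 minimizes the linear objective over the tangent set with th = 0, so no
     quadratic term is needed. *)
  have [w Tw|l [El _ dl ll]] := mult 0 0 0 (gradf xb) (lexx _) T0.
    by have := ge0 _ _ Tw; rewrite mul0r mul0r subr0 addr0.
  exists l; first by split; rewrite ?DgE ?DgTE.
  split; last by rewrite tcone2aE DgE; move: ll; rewrite mul0mx scale0r addr0.
  apply: ge_ereal_sup => _ [_ [w Tw <-] <-]; rewrite lee_fin DgE dotDg// oppr_le0.
  by have := ge0 _ _ Tw; rewrite mul0r addr0.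
rewrite tcone2E DgE => -[u0 Tu0].
(* The error bound transfers nonemptiness from the tangent set of K to that of C; with [ge0] this
   makes alpha finite. *)
have [w0 Tw0 _] := tconer_error_bound taylor_g rho0 delta0 ka0 mscq 0 Tu0.
have aE : alpha = ereal_inf [set (dotp (gradf xb) w + quadf (hessf xb) d)%:E
    | w in tconer 1 C xb d] by rewrite /alpha tcone2E.
set hfd := quadf (hessf xb) d in aE *.
have [a aR] : exists a : R, alpha = a%:E.
  have : alpha \is a fin_num.
    rewrite fin_numElt; apply/andP; split.
      apply: (@lt_le_trans _ _ 0%E); first exact: ltNyr.
      rewrite aE; apply/ereal_infP => _ [w Tw <-]; rewrite lee_fin.
      by have := ge0 _ _ Tw; rewrite mul1r.
    apply: (@le_lt_trans _ _ (dotp (gradf xb) w0 + hfd)%:E); last exact: ltry.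
    by rewrite aE; apply: ereal_inf_lbound; exists w0.
  by move=> /fineK <-; exists (fine alpha).
have aW w : tconer 1 C xb d w -> a - hfd <= dotp (gradf xb) w.
  move=> Tw; rewrite lerBlDr -lee_fin -aR aE.
  by apply: ereal_inf_lbound; exists w.
have aI (e : R) : 0 < e -> exists2 w, tconer 1 C xb d w &
    dotp (gradf xb) w < a - hfd + e.
  move=> e0; have : (alpha < (a + e)%:E)%E by rewrite aR lte_fin ltrDl.
  rewrite aE => /ereal_inf_lt[_ [w Tw <-]]; rewrite lte_fin => lt.
  by exists w => //; lra.
(* Only the multipliers cluster; the points w may be unbounded. The norm bound is that of [mult] for
   the cost [gradf xb + eps *: w] with |eps w| < e. *)
have [|e [w l] /= e1 [_ _ lB _ _]|l small] := @bounded_cluster_scale R _ m (fun e p =>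
    [/\ tconer 1 C xb d p.1, dnormal K (g xb) (d *m A) p.2 /\
      lnormal (tconer 1 K (g xb) (d *m A)) (p.1 *m A + D2g) p.2,
      enorm p.2 <= 4 * ka * (enorm (gradf xb) + e) + 2,
      enorm (gradf xb + p.2 *m A^T) < e &
      dotp (gradf xb) p.1 < a - hfd + e /\
      `|dotp (p.2 *m A^T + gradf xb) p.1| < e])
    snd (4 * ka * (enorm (gradf xb) + 1) + 2).
- move=> e e0; have e4 : 0 < e / 4 by lra.
  have [w1 Tw1 hw1] := aI _ e4.
  have [eps [w [eps0 Tw wa [ew nw] wopt]]] :=
    regularized_minimizer (@tconer_closed _ _ _ _ _ _) aW e0 Tw1 hw1.
  have eps2 : 0 <= eps / 2 by lra.
  have [l [El nl dl ll]] := mult _ _ _ _ eps2 Tw wopt.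
  have E : gradf xb + l *m A^T = - (eps *: w).
    by apply/eqP; rewrite -subr_eq0 opprK addrAC; apply/eqP.
  exists (w, l); split=> //=.
  - by split=> //; rewrite -[D2g]scale1r.
  - apply: le_trans nl _; rewrite lerD2r ler_wpM2l//; last first.
      by apply: le_trans (enormD _ _) _; rewrite lerD2l ltW.
    by rewrite mulr_ge0// ltW.
  - by rewrite E enormN.
  (* The stationarity residual is - eps w, so its product with w is - eps |w|^2, which the
     regularization keeps below e in absolute value. *)
  - split=> //; rewrite addrC E dotpNl dotpZl normrN -sqr_enorm ger0_norm//.
    by rewrite mulr_ge0 ?sqr_ge0// ltW.
- apply: le_trans lB _; rewrite lerD2r ler_wpM2l ?lerD2l//.
  by rewrite mulr_ge0// ltW.
have El : gradf xb + l *m A^T = 0.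
  have [b b0 hb] := mulmx_bounded A^T.
  apply: enorm0_eq0; apply/eqP; rewrite eq_le enorm_ge0 andbT.
  apply/ler_addgt0Pr => e e0; rewrite add0r.
  have [t t0 eE] : exists2 t, 0 < t & e = t * (b + 1).
    have b1 : 0 < b + 1 by lra.
    by exists (e / (b + 1)); rewrite ?divr_gt0// divfK// gt_eqF.
  have [e' [[w l'] /= [e't [_ _ _ ck _] ll']]] := small _ t0.
  rewrite (_ : _ + _ = (gradf xb + l' *m A^T) - (l' - l) *m A^T); last first.
    by rewrite mulmxBl opprB addrACA addrA addrK.
  apply: le_trans (enormB _ _) _.
  have h1 : enorm ((l' - l) *m A^T) <= b * t.
    by apply: le_trans (hb _) _; rewrite ler_wpM2l// ltW.
  rewrite eE; lra.
exists l.
  split; last by rewrite DgTE.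
  rewrite DgE; apply: dnormal_adherent => e e0.
  by have [e' [[w l'] /= [_ [_ [? _] _ _ _] ?]]] := small _ e0; exists l'.
split.
  (* For each w the claim reduces by stationarity to [ge0] with th = 1, the constraint curvature <l,
     D2g> cancelling on both sides. *)
  rewrite sube_ge0 ?orbT//; apply: ge_ereal_sup => _ [_ [w Tw <-] <-].
  rewrite tcone2E in Tw; rewrite lee_fin DgE dotpDr dotDg// /hessL.
  have -> : \sum_(i < m) l ord0 i * quadf (hessg i xb) d = dotp l D2g.
    by apply: eq_bigr => i _; rewrite mxE.
  by have := ge0 _ _ Tw; rewrite mul1r; lra.
have /choice[p hp] : forall k : nat, exists p : 'rV[R]_n * 'rV[R]_m,
    [/\ tconer 1 C xb d p.1,
      lnormal (tconer 1 K (g xb) (d *m A)) (p.1 *m A + D2g) p.2,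
      dotp (gradf xb) p.1 < a - hfd + k.+1%:R^-1,
      `|dotp (p.2 *m A^T + gradf xb) p.1| < k.+1%:R^-1 &
      enorm (p.2 - l) < k.+1%:R^-1].
  move=> k; have [|e' [[w l'] /= [ee' [Tw [_ ll'] _ _ [wa wl]] l'l]]] := small k.+1%:R^-1.
    by rewrite invr_gt0.
  exists (w, l'); split=> //=; last exact: lt_trans wl ee'.
  by rewrite (lt_trans wa)// ltrD2l.
exists (fun k => (p k).1), (fun k => (p k).2); split.
- by move=> k; rewrite tcone2E; have [] := hp k.
- by move=> k; rewrite DgE; have [] := hp k.
(* The values are squeezed between alpha and alpha + 1 / (k + 1). *)
- rewrite aR; apply: cvg_EFin; first by near=> k.
  apply: natSinv_cvg => k /=; have [Tk _ lt _ _] := hp k.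
  have := aW _ Tk; move: lt.
  move: (k.+1%:R^-1) => i; rewrite ltr_norml; lra.
- by apply: natSinv_cvg => k; rewrite subr0 DgTE; have [] := hp k.
- by apply: natSinv_cvg_row => k; have [] := hp k.
Unshelve. all: by end_near. Qed.
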